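(* With the notation of the context, the set $$\left\{\frac{\hat\phi_i\,dx}{y_{\hat r}y_{\hat s}}\ \Big|\ i=0,1,2,\dots\right\}$$ is a basis of $H^0(X\setminus\{\infty\},\Omega_X)$ as a $\mathbb{C}$-vector space (differentials regular on $X\setminus\{\infty\}$ and meromorphic at $\infty$). In particular, a basis of $H^0(X,\Omega_X)$ is given by $$\left\{\nu^I_i:=\frac{\hat\phi_{i-1}\,dx}{3y_{\hat r}y_{\hat s}}\ \Big|\ i=1,2,\dots,g\right\}.$$
   Context: Let $r,s$ be integers with $0<r<s$ and $r\not\equiv s \pmod 3$. Put $\hat r=2r+s$, $\hat s=2s+r$ (so $3,\hat r,\hat s$ is the minimal set of generators of the numerical semigroup they generate) and $g=r+s-1$. Let $b_1,\dots,b_{r+s}\in\mathbb{C}$ be pairwise distinct, $k_s(x)=\prod_{i=1}^{s}(x-b_i)$, $k_r(x)=\prod_{i=s+1}^{s+r}(x-b_i)$, and $$R=\mathbb{C}[x,y_{\hat r},y_{\hat s}]/\bigl(y_{\hat r}^2-y_{\hat s}k_r(x),\ y_{\hat r}y_{\hat s}-k_r(x)k_s(x),\ y_{\hat s}^2-y_{\hat r}k_s(x)\bigr).$$ $\mathrm{Spec}\,R$ is a non-singular affine curve; $X$ denotes the compact Riemann surface (of genus $g$) obtained by adding one point $\infty$. The weight $\mathrm{wt}(f)$ of $f\in R$ is its pole order at $\infty$; $\mathrm{wt}(x)=3$, $\mathrm{wt}(y_{\hat r})=\hat r$, $\mathrm{wt}(y_{\hat s})=\hat s$. Let $B_i=(x=b_i,\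 y_{\hat r}=0,\ y_{\hat s}=0)\in X$ for $i=1,\dots,r+s$, and let $\widehat R\subset R$ be the subspace of $f\in R$ vanishing at all the points $B_1,\dots,B_{r+s}$. The space $\widehat R$ has the basis consisting of the monomials $x^ay_{\hat r}$, $x^ay_{\hat s}$, $x^ay_{\hat r}y_{\hat s}$ ($a\ge 0$), whose weights are pairwise distinct; $\hat\phi_0,\hat\phi_1,\hat\phi_2,\dots$ denotes this basis ordered by strictly increasing weight. *)

(* Defs.v *)
From HB Require Import structures.
From mathcomp Require Import all_boot all_order all_algebra.
From mathcomp Require Import boolp reals.
From mathcomp Require Import complex mpoly.

Set Implicit Arguments.
Unset Strict Implicit.
Unset Printing Implicit Defensive.

Import Order.TTheory GRing.Theory Num.Theory.
Local Open Scope ring_scope.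

(* The affine ring, for arbitrary k_r and k_s: the coordinates 'X_0, 'X_1, 'X_2
   stand for x, y_rhat, y_shat. *)
Section CurveRing.
Variables (C : numClosedFieldType) (kr ks : {poly C}).

Definition in_x (k : {poly C}) : {mpoly C[3]} :=
  (map_poly (@mpolyC 3 C) k).['X_(inord 0)].

Definition rel_rr : {mpoly C[3]} :=
  'X_(inord 1) ^+ 2 - 'X_(inord 2) * in_x kr.
Definition rel_rs : {mpoly C[3]} :=
  'X_(inord 1) * 'X_(inord 2) - in_x kr * in_x ks.
Definition rel_ss : {mpoly C[3]} :=
  'X_(inord 2) ^+ 2 - 'X_(inord 1) * in_x ks.

Definition curve_ideal : pred {mpoly C[3]} := fun p =>
  `[< exists u1 u2 u3 : {mpoly C[3]},
        p = u1 * rel_rr + u2 * rel_rs + u3 * rel_ss >].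

(* A zero of the three relations on the line x = 0, so that 1 is not in the
   ideal. *)
Lemma curve_has_point : exists h : 'I_3 -> C,
  [/\ rel_rr.@[h] = 0, rel_rs.@[h] = 0 & rel_ss.@[h] = 0].
Proof.
have evX (h : 'I_3 -> C) k : (in_x k).@[h] = k.[h (inord 0)].
  rewrite /in_x -(mevalXU h (inord 0)) -[LHS]horner_map /= -map_poly_comp.
  by rewrite mevalXU map_poly_id // => c _ /=; rewrite mevalC.
pose a := kr.[0]; pose e := ks.[0].
pose y := 3.-root (a ^+ 2 * e).
have y3 : y ^+ 3 = a ^+ 2 * e by rewrite rootCK.
pose h0 (y1 y2 : C) (i : 'I_3) : C := nth 0 [:: 0; y1; y2] i.
have h00 y1 y2 : h0 y1 y2 (inord 0) = 0 by rewrite /h0 inordK.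
have h01 y1 y2 : h0 y1 y2 (inord 1) = y1 by rewrite /h0 inordK.
have h02 y1 y2 : h0 y1 y2 (inord 2) = y2 by rewrite /h0 inordK.
have [a0|an0] := eqVneq a 0.
  exists (h0 0 0).
  rewrite !(mevalB, mevalM, rmorphXn) /= !evX !mevalXU h00 h01 h02 -/a a0.
  by split; rewrite ?expr0n /= ?mul0r ?mulr0 ?subrr.
exists (h0 y (y ^+ 2 / a)).
rewrite !(mevalB, mevalM, rmorphXn) /= !evX !mevalXU h00 h01 h02 -/a -/e.
have ya : y * (y ^+ 2 / a) = a * e.
  by rewrite mulrA -exprS y3 expr2 -!mulrA (mulrC e) mulVKf.
split; first by rewrite divfK ?subrr.
  by rewrite ya subrr.
have -> : y ^+ 2 / a * (y ^+ 2 / a) = y * (y * (y ^+ 2 / a)) / a.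
  by rewrite expr2 -!mulrA !(mulrCA a^-1).
by rewrite ya (mulrC a) mulrA mulfK // subrr.
Qed.

Lemma curve_ideal_closed : idealr_closed curve_ideal.
Proof.
split.
- by apply/asboolP; exists 0, 0, 0; rewrite !mul0r !addr0.
- apply/negP => /asboolP [u1 [u2 [u3 E]]].
  have [h [h1 h2 h3]] := curve_has_point.
  have := congr1 (meval h) E.
  move: (rel_rr) (rel_rs) (rel_ss) h1 h2 h3 => p1 p2 p3 h1 h2 h3.
  rewrite !(mevalD, mevalM) h1 h2 h3 meval1 !mulr0 !addr0 => /eqP.
  by rewrite oner_eq0.
- move=> a u w /asboolP [u1 [u2 [u3 ->]]] /asboolP [w1 [w2 [w3 ->]]].
  apply/asboolP; exists (a * u1 + w1), (a * u2 + w2), (a * u3 + w3).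
  rewrite !mulrDl !mulrDr !mulrA.
  by rewrite addrACA [X in X + _ = _]addrACA.
Qed.

HB.instance Definition _ :=
  isIdealr.Build {mpoly C[3]} curve_ideal curve_ideal_closed.

Definition curve_idealr : idealr {mpoly C[3]} := curve_ideal.
Definition curve_ring := {ideal_quot curve_idealr}.
HB.instance Definition _ := GRing.ComNzRing.on curve_ring.

Definition to_curve (p : {mpoly C[3]}) : curve_ring :=
  \pi_({ideal_quot curve_idealr})%qT p.

Definition cst (c : C) : curve_ring := to_curve c%:MP.
Definition xx : curve_ring := to_curve 'X_(inord 0).
Definition yr : curve_ring := to_curve 'X_(inord 1).
Definition ys : curve_ring := to_curve 'X_(inord 2).

Definition hat_monomial (f : curve_ring) : Prop :=
  exists a : nat,
    [\/ f = xx ^+ a * yr, f = xx ^+ a * ys | f = xx ^+ a * (yr * ys)].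

(* A closed point of Spec R is a morphism of C-algebras R -> C, namely
   evaluation at that point. *)
Definition closed_point (P : {rmorphism curve_ring -> C}) : Prop :=
  forall c : C, P (cst c) = c.

End CurveRing.

Arguments cst {C kr ks} c.
Arguments xx {C kr ks}.
Arguments yr {C kr ks}.
Arguments ys {C kr ks}.

Definition is_fraction_field (A : comNzRingType) (K : fieldType)
    (iota : {rmorphism A -> K}) : Prop :=
  injective iota /\
  forall f : K, exists a b : A, b != 0 /\ f = iota a / iota b.

(* Kaehler differentials of K over C, through their universal property; the
   C-algebra structure of K is the map sc : C -> K. *)
Section Differentials.
Variables (C : Type) (K : fieldType) (sc : C -> K).

Definition is_derivation (M : lmodType K) (D : K -> M) : Prop :=
  [/\ forall f g, D (f + g) = D f + D g,
      forall f g, D (f * g) = f *: D g + g *: D f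
    & forall c, D (sc c) = 0].

Definition is_kaehler (Omega : lmodType K) (d : K -> Omega) : Prop :=
  is_derivation d /\
  forall (M : lmodType K) (D : K -> M), is_derivation D ->
    exists h : {linear Omega -> M}, (forall f, h (d f) = D f) /\
      forall h' : {linear Omega -> M}, (forall f, h' (d f) = D f) -> h' =1 h.

(* For a local ring O of the curve, the differentials lying in the image of
   Omega_(O/C) in Omega_(K/C). *)
Definition regular_at (Omega : lmodType K) (d : K -> Omega) (O : K -> Prop)
    (w : Omega) : Prop :=
  exists (n : nat) (f g : 'I_n -> K),
    (forall i, O (f i) /\ O (g i)) /\ w = \sum_(i < n) f i *: d (g i).

End Differentials.

(* The family e, indexed by I, is a C-basis of the subspace H of a K-vector
   space, where C acts through sc. *)
Definition is_basis (C : nzRingType) (K : fieldType) (sc : C -> K)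
    (V : lmodType K) (H : V -> Prop) (I : eqType) (e : I -> V) : Prop :=
  [/\ forall i, H (e i),
      forall (S : seq I) (c : I -> C), uniq S ->
        \sum_(i <- S) sc (c i) *: e i = 0 -> forall i, i \in S -> c i = 0
    & forall w, H w -> exists (S : seq I) (c : I -> C),
        w = \sum_(i <- S) sc (c i) *: e i].

(* v is only meaningful away from 0. *)
Definition is_normalized_valuation (C : nzRingType) (K : fieldType)
    (sc : C -> K) (v : K -> int) : Prop :=
  [/\ forall f g, f != 0 -> g != 0 -> v (f * g) = v f + v g,
      forall f g, f != 0 -> g != 0 -> f + g != 0 ->
        Num.min (v f) (v g) <= v (f + g),
      forall c, c != 0 -> v (sc c) = 0
    & forall n : int, exists2 f, f != 0 & v f = n].

Definition valuation_ring (K : fieldType) (v : K -> int) (f : K) : Prop :=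
  f = 0 \/ 0 <= v f.

(* The compact curve X = Spec R + {infinity}, given through its function field
   K and the order function v of K at infinity. *)
Section CompactCurve.
Variables (C : numClosedFieldType) (kr ks : {poly C}).
Variables (K : fieldType) (iota : {rmorphism curve_ring kr ks -> K}).
Variables (Omega : lmodType K) (d : K -> Omega) (v : K -> int).

Definition cstK (c : C) : K := iota (cst c).

Definition local_ring (P : {rmorphism curve_ring kr ks -> C}) (f : K) : Prop :=
  exists a b : curve_ring kr ks, P b != 0 /\ f = iota a / iota b.

Definition is_order_at_infinity : Prop :=
  is_normalized_valuation cstK v /\
  exists f : curve_ring kr ks, ~ valuation_ring v (iota f).

Definition weight (f : curve_ring kr ks) : int := - v (iota f).

(* H^0(X \ {infinity}, Omega_X) *)
Definition H0_affine (w : Omega) : Prop :=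
  forall P : {rmorphism curve_ring kr ks -> C}, closed_point P ->
    regular_at d (local_ring P) w.

(* H^0(X, Omega_X) *)
Definition H0 (w : Omega) : Prop :=
  H0_affine w /\ regular_at d (valuation_ring v) w.

End CompactCurve.

(* The points b_1, ..., b_(r+s) are indexed from 0. *)
Section BranchPolynomials.
Variables (C : numClosedFieldType) (r s : nat) (b : 'I_(r + s) -> C).

Definition k_s : {poly C} := \prod_(i < r + s | (i < s)%N) ('X - (b i)%:P).
Definition k_r : {poly C} := \prod_(i < r + s | (s <= i)%N) ('X - (b i)%:P).

End BranchPolynomials.

(* Main.v *)
Require Import Defs.
From HB Require Import structures.
From mathcomp Require Import all_boot all_order all_algebra.
From mathcomp Require Import boolp reals.
From mathcomp Require Import complex mpoly.
From mathcomp Require Import separable zify ring.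

Set Implicit Arguments.
Unset Strict Implicit.
Unset Printing Implicit Defensive.

Import Order.TTheory GRing.Theory Num.Theory.
Local Open Scope ring_scope.

(* Every element of R is a combination of the monomials x^a, x^a y_r, x^a y_s,
   whose orders at infinity are pairwise distinct, so that orders at infinity
   are read off leading terms. The function field K has the derivation d/dx, and
   y_r y_s d/dx maps R into the ideal (y_r, y_s), which is the space of functions
   vanishing at the B_i. Hence if h dx is regular at every finite point, then
   h y_r y_s lies locally, and by the weak Nullstellensatz globally, in
   (y_r, y_s); the converse uses y_r or y_s as a local parameter at the B_i. At
   infinity d/dx raises orders by at least 3, and to at least 4 on integral
   elements because the residue field is C; so h dx is regular there iff h has
   order at least 4. The weights of the hat monomials that satisfy this bound
   are then counted. *)

(** * Valuations *)

(** [K], [Omega] and [v] are given only through their defining properties, so the order of x, the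
    derivation d/dx and the non-vanishing of dx all have to be derived. The condition that r and s
    differ mod 3 acts repeatedly: it separates the orders of the monomials, forces x to have order
    -3, keeps norms to C[x] nonzero, and makes the final count equal r + s - 1. Norms keep the
    passage from local to global elementary: a proper ideal of R containing a nonzero polynomial in
    x has a zero, because the cubes of y_r and y_s lie in C[x]. The bound 4 is the pole order of dx:
    for a uniformizer t the unit x t^3 differs from a constant by something of positive order, and
    differentiating this gives dt/dx the order 4. That the b_i are distinct enters as [sep], for the
    local parameters at the B_i. *)

Section Valuation.
Variables (C K : fieldType) (sc : {rmorphism C -> K}) (v : K -> int).
Hypothesis hv : is_normalized_valuation sc v.

(** The disjunct f = 0 stands for v(0) = infinity, as [v] carries no information at 0. *)
Definition val_ge (n : int) (f : K) : Prop := f = 0 \/ n <= v f.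

Lemma valM f g : f != 0 -> g != 0 -> v (f * g) = v f + v g.
Proof. by case: hv => + _ _ _; apply. Qed.

Lemma val_const c : c != 0 -> v (sc c) = 0.
Proof. by case: hv => _ _ + _; apply. Qed.

Lemma val1 : v 1 = 0.
Proof. by rewrite -(rmorph1 sc) val_const ?oner_eq0. Qed.

Lemma valV f : f != 0 -> v f^-1 = - v f.
Proof.
move=> f0; apply/eqP; rewrite -addr_eq0 addrC -valM ?invr_eq0 //.
by rewrite divff // val1.
Qed.

Lemma valN f : v (- f) = v f.
Proof.
have [->|f0] := eqVneq f 0; first by rewrite oppr0.
rewrite -mulN1r valM ?oppr_eq0 ?oner_eq0 //.
by rewrite -(rmorphN1 sc) val_const ?add0r // oppr_eq0 oner_eq0.
Qed.

Lemma valXn f n : f != 0 -> v (f ^+ n) = v f *+ n.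
Proof.
move=> f0; elim: n => [|n IHn]; first by rewrite expr0 val1.
by rewrite exprS valM ?expf_neq0 // IHn mulrS.
Qed.

Lemma val_gew m n f : m <= n -> val_ge n f -> val_ge m f.
Proof. by move=> mn [->|nf]; [left|right; apply: le_trans nf]. Qed.

Lemma val_geP n f : f != 0 -> val_ge n f -> n <= v f.
Proof. by move=> f0 [fe|]; [rewrite fe eqxx in f0|]. Qed.

Lemma val_geN n f : val_ge n f -> val_ge n (- f).
Proof. by move=> [->|?]; [left; rewrite oppr0|right; rewrite valN]. Qed.

Lemma val_geD n f g : val_ge n f -> val_ge n g -> val_ge n (f + g).
Proof.
move=> [->|nf]; first by rewrite add0r.
move=> [->|ng]; first by rewrite addr0; right.
have [->|f0] := eqVneq f 0; first by rewrite add0r; right.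
have [->|g0] := eqVneq g 0; first by rewrite addr0; right.
have [->|fg0] := eqVneq (f + g) 0; first by left.
right; case: hv => _ + _ _ => /(_ f g f0 g0 fg0).
by apply: le_trans; rewrite le_min nf.
Qed.

Lemma val_geB n f g : val_ge n f -> val_ge n g -> val_ge n (f - g).
Proof. by move=> nf ng; apply: val_geD => //; apply: val_geN. Qed.

Lemma val_geM m n f g : val_ge m f -> val_ge n g -> val_ge (m + n) (f * g).
Proof.
move=> [->|mf]; first by rewrite mul0r; left.
move=> [->|ng]; first by rewrite mulr0; left.
have [->|f0] := eqVneq f 0; first by rewrite mul0r; left.
have [->|g0] := eqVneq g 0; first by rewrite mulr0; left.
by right; rewrite valM // lerD.
Qed.

Lemma val_ge_const c : val_ge 0 (sc c).
Proof.
have [->|c0] := eqVneq c 0; first by rewrite rmorph0; left.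
by right; rewrite val_const.
Qed.

Lemma val_geMl n c f : val_ge n f -> val_ge n (sc c * f).
Proof. by move=> nf; have := val_geM (val_ge_const c) nf; rewrite add0r. Qed.

Lemma val_ge_sum (I : Type) (S : seq I) (P : pred I) n (F : I -> K) :
  (forall i, P i -> val_ge n (F i)) -> val_ge n (\sum_(i <- S | P i) F i).
Proof. by move=> nF; apply: big_rec => [|i x /nF]; [left|apply: val_geD]. Qed.

Lemma val_geX f n : val_ge 0 f -> val_ge 0 (f ^+ n).
Proof.
move=> f0; elim: n => [|n IHn]; first by right; rewrite expr0 val1.
by have := val_geM f0 IHn; rewrite addr0 exprS.
Qed.

Lemma val_ge_root f n : (0 < n)%N -> val_ge 0 (f ^+ n) -> val_ge 0 f.
Proof.
move=> n0 [/eqP|]; first by rewrite expf_eq0 => /andP [_ /eqP]; left.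
have [->|f0] := eqVneq f 0; first by left.
by rewrite valXn // pmulrn_lge0 //; right.
Qed.

(** A larger order of f + g would carry over to f = (f + g) - g. *)
Lemma val_dominant f g : f != 0 -> val_ge (v f + 1) g ->
  f + g != 0 /\ v (f + g) = v f.
Proof.
move=> f0 [->|fg]; first by rewrite addr0.
have fg0 : f + g != 0.
  apply/eqP => /(canRL (addKr _)); rewrite addr0 => gf.
  by move: fg; rewrite gf valN; lia.
split=> //.
have h1 : val_ge (v f) (f + g) by apply: val_geD; right; lia.
have := val_geP fg0 h1; rewrite le_eqVlt => /predU1P [//|h2].
have : val_ge (v f + 1) (f + g - g) by apply: val_geB; right; lia.
by rewrite addrK => /(val_geP f0); lia.
Qed.

(* Distinct valuations cannot cancel, so a combination is led by its term of
   least valuation. *)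
Lemma val_lead (I : eqType) (S : seq I) (F : I -> K) (c : I -> C) :
  uniq S -> (forall i, i \in S -> F i != 0) ->
  {in S &, injective (v \o F)} -> (exists2 i, i \in S & c i != 0) ->
  exists2 i, i \in S /\ c i != 0 &
  [/\ \sum_(j <- S) sc (c j) * F j != 0,
      v (\sum_(j <- S) sc (c j) * F j) = v (F i),
      val_ge (v (F i) + 1) (\sum_(j <- S) sc (c j) * F j - sc (c i) * F i)
    & forall j, j \in S -> c j != 0 -> v (F i) <= v (F j)].
Proof.
move=> uS F0 Finj [i0 i0S ci0].
have [i [iS ci imin]] : exists i, [/\ i \in S, c i != 0 &
    forall j, j \in S -> c j != 0 -> v (F i) <= v (F j)].
  elim: (S) i0 i0S ci0 => // a T IH i1.
  have [/hasP [i2 i2T ci2] _ _|noT] := boolP (has (fun j => c j != 0) T).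
    have [i [iT ci imin]] := IH _ i2T ci2.
    have [ca|] := eqVneq (c a) 0.
      exists i; split=> // [|j]; first by rewrite inE iT orbT.
      by rewrite inE => /predU1P [->|]; [rewrite ca eqxx|apply: imin].
    have [ai ca|ia _] := lerP (v (F a)) (v (F i)).
      exists a; split=> // [|j]; first by rewrite inE eqxx.
      rewrite inE => /predU1P [->//|jT cj].
      by apply: le_trans ai _; apply: imin.
    exists i; split=> // [|j]; first by rewrite inE iT orbT.
    by rewrite inE => /predU1P [-> _|]; [apply: ltW|apply: imin].
  have h j : j \in a :: T -> c j != 0 -> j = a.
    rewrite inE => /predU1P [//|jT cj].
    by case/hasP: noT; exists j.
  move=> i1T ci1; exists i1; split=> // j jT cj.
  by rewrite (h i1) // (h j).
exists i; first by split.
rewrite (bigD1_seq i) //=.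
have sci : sc (c i) != 0 by rewrite fmorph_eq0.
have Fi0 := F0 _ iS.
have vi : v (sc (c i) * F i) = v (F i) by rewrite valM // val_const // add0r.
have rest : val_ge (v (F i) + 1) (\sum_(j <- S | j != i) sc (c j) * F j).
  rewrite big_seq_cond; apply: val_ge_sum => j /andP [jS ji].
  have [->|cj] := eqVneq (c j) 0; first by rewrite rmorph0 mul0r; left.
  apply: val_geMl; right.
  have := imin _ jS cj; rewrite le_eqVlt => /predU1P [vij|]; last by lia.
  by move/Finj: vij => /(_ iS jS) ij; rewrite ij eqxx in ji.
have [n0 vE] : _ /\ _ := @val_dominant (sc (c i) * F i) _ (mulf_neq0 sci Fi0)
  (eq_ind_r (fun n => val_ge (n + 1) _) rest vi).
by split=> //; [rewrite vE|rewrite addrAC subrr add0r].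
Qed.

Lemma val_ge_lead (I : eqType) (S : seq I) (F : I -> K) (c : I -> C) n :
  uniq S -> (forall i, i \in S -> F i != 0) ->
  {in S &, injective (v \o F)} -> val_ge n (\sum_(i <- S) sc (c i) * F i) ->
  forall i, i \in S -> c i != 0 -> n <= v (F i).
Proof.
move=> uS F0 Finj nS i iS ci.
have [|j _ [s0 vj _ jmin]] := @val_lead _ S F c uS F0 Finj; first by exists i.
by apply: le_trans (jmin i iS ci); rewrite -vj; apply: val_geP.
Qed.

Lemma val_independent (I : eqType) (S : seq I) (F : I -> K) (c : I -> C) :
  uniq S -> (forall i, i \in S -> F i != 0) ->
  {in S &, injective (v \o F)} -> \sum_(i <- S) sc (c i) * F i = 0 ->
  forall i, i \in S -> c i = 0.
Proof.
move=> uS F0 Finj S0 i iS; apply/eqP/negPn/negP => ci.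
have [|j _ []] := @val_lead _ S F c uS F0 Finj; first by exists i.
by rewrite S0 eqxx.
Qed.

End Valuation.

(** * Derivations *)

(** The two maps [sc] and [ev] let one chain rule serve both derivations of [K] and [K]-valued
    derivations of the polynomial ring in three variables. *)
Lemma derivation_horner (C A : comNzRingType) (K : fieldType)
    (sc : {rmorphism C -> A}) (ev : {rmorphism A -> K}) (M : lmodType K)
    (D : A -> M) (p : {poly C}) (u : A) :
  (forall f g, D (f + g) = D f + D g) ->
  (forall f g, D (f * g) = ev f *: D g + ev g *: D f) ->
  (forall c, D (sc c) = 0) ->
  D (map_poly sc p).[u] = ev (map_poly sc p^`()).[u] *: D u.
Proof.
move=> DD DM DC; elim/poly_ind: p => [|p c IHp].
  by rewrite deriv0 rmorph0 horner0 rmorph0 scale0r -(rmorph0 sc) DC.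
rewrite rmorphD rmorphM /= map_polyX map_polyC hornerD hornerMX hornerC.
rewrite derivMXaddC rmorphD rmorphM /= map_polyX hornerD hornerMX.
rewrite DD DC addr0 DM IHp rmorphD rmorphM /= scalerDl scalerA.
by congr (_ + _); rewrite mulrC.
Qed.

Lemma derivation_div (C : Type) (K : fieldType) (sc : C -> K) (M : lmodType K)
    (D : K -> M) f g :
  is_derivation sc D -> g != 0 ->
  D (f / g) = g^-1 *: D f - (f / g ^+ 2) *: D g.
Proof.
case=> _ DM _ g0; have := DM (f / g) g; rewrite divfK // => ->.
rewrite scalerDr !scalerA mulVf // scale1r [_^-1 * _]mulrC -mulrA -invfM.
by rewrite -expr2 [X in X - _]addrC addrK.
Qed.

Lemma derivation_extend (A : comNzRingType) (K : fieldType)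
    (iota : {rmorphism A -> K}) (DA : A -> K) :
  is_fraction_field iota ->
  (forall f g, DA (f + g) = DA f + DA g) ->
  (forall f g, DA (f * g) = iota f * DA g + iota g * DA f) ->
  exists D : K -> K, [/\ forall a, D (iota a) = DA a,
    forall f g, D (f + g) = D f + D g
  & forall f g, D (f * g) = f * D g + g * D f].
Proof.
move=> [inj frac] DD DM.
have i0 a : a != 0 -> iota a != 0 by rewrite -(rmorph0 iota) (inj_eq inj).
have frac' f : {ab : A * A | ab.2 != 0 /\ f = iota ab.1 / iota ab.2}.
  by apply: cid; have [a [b ?]] := frac f; exists (a, b).
pose num f := (sval (frac' f)).1; pose den f := (sval (frac' f)).2.
have den0 f : iota (den f) != 0 by rewrite i0 // (svalP (frac' f)).1.
have fE f : f = iota (num f) / iota (den f) := (svalP (frac' f)).2.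
pose D f := (iota (den f) * DA (num f) - iota (num f) * DA (den f))
              / iota (den f) ^+ 2.
(* The quotient rule gives the same value on every fraction representing [f]: apply [DA] to the
   cross-multiplied identity [E]. *)
have DE f a b : iota b != 0 -> f = iota a / iota b ->
    D f = (iota b * DA a - iota a * DA b) / iota b ^+ 2.
  move=> b0 fab; rewrite /D.
  have E : num f * b = a * den f.
    apply: inj; rewrite !rmorphM; apply/eqP.
    by rewrite -eqr_div // -fE fab.
  have E1 : iota (num f) * iota b = iota a * iota (den f).
    by rewrite -!rmorphM E.
  have := congr1 DA E; rewrite !DM => E2.
  have na : iota (num f) = iota a * iota (den f) / iota b.
    by rewrite -E1 mulfK.
  have E3 : DA (num f) =
      (iota a * DA (den f) + iota (den f) * DA a - iota (num f) * DA b) / iota b.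
    by rewrite -E2 addrC addrA addNr add0r mulrAC divff // mul1r.
  by rewrite E3 na; field; rewrite b0 den0.
exists D; split=> [a|f g|f g].
- rewrite (DE _ a 1) ?rmorph1 ?oner_eq0 ?divr1 //.
  have := DM 1 1; rewrite !mulr1 rmorph1 !mul1r => /eqP.
  rewrite -[X in X == _]addr0 (inj_eq (addrI _)) eq_sym => /eqP ->.
  by rewrite expr1n mulr0 subr0 divr1.
- rewrite (DE (f + g) (num f * den g + num g * den f) (den f * den g)).
  + by rewrite /D DD !DM !rmorphD !rmorphM /=; field; rewrite !den0.
  + by rewrite rmorphM mulf_neq0.
  + rewrite {1}(fE f) {1}(fE g) !rmorphD !rmorphM /=.
    by field; rewrite !den0.
- rewrite (DE (f * g) (num f * num g) (den f * den g)).
  + transitivity (iota (num f) / iota (den f) * D g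
                  + iota (num g) / iota (den g) * D f); last by rewrite -!fE.
    rewrite /D !DM !rmorphM /=.
    by field; rewrite !den0.
  + by rewrite rmorphM mulf_neq0.
  + rewrite {1}(fE f) {1}(fE g) !rmorphM /=.
    by field; rewrite !den0.
Qed.

(** * The affine ring *)

Section CurveAlgebra.
Variables (C : numClosedFieldType) (kr ks : {poly C}).
Local Notation A := (curve_ring kr ks).

HB.instance Definition _ := GRing.RMorphism.copy (@to_curve C kr ks)
  (\pi_({ideal_quot (curve_idealr kr ks)})%qT).
HB.instance Definition _ := GRing.RMorphism.copy (@cst C kr ks)
  (@to_curve C kr ks \o @mpolyC 3 C).

Definition ofx (p : {poly C}) : A := (map_poly (@cst C kr ks) p).[xx].

HB.instance Definition _ := GRing.RMorphism.copy ofx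
  (horner_eval (xx : A) \o map_poly (@cst C kr ks)).

Lemma ofxX : ofx 'X = xx. Proof. by rewrite /ofx map_polyX hornerX. Qed.

Lemma ofxC c : ofx c%:P = cst c.
Proof. by rewrite /ofx map_polyC hornerC. Qed.

Lemma in_x_curve k : to_curve kr ks (in_x k) = ofx k.
Proof.
by rewrite /in_x -[LHS]horner_map /= -map_poly_comp.
Qed.

Lemma to_curveK (a : A) : exists p, a = to_curve kr ks p.
Proof. by exists (repr a); rewrite /to_curve reprK. Qed.

Lemma to_curve_eq p q :
  to_curve kr ks p = to_curve kr ks q -> curve_ideal kr ks (p - q).
Proof. by move/eqP; rewrite /to_curve -Quotient.idealrBE. Qed.

Lemma to_curve_ideal p : curve_ideal kr ks p -> to_curve kr ks p = 0.
Proof.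
move=> pI; rewrite -(rmorph0 (to_curve kr ks)); apply/eqP.
by rewrite /to_curve -Quotient.idealrBE subr0.
Qed.

Lemma to_curve_rels : [/\ to_curve kr ks (rel_rr kr) = 0,
  to_curve kr ks (rel_rs kr ks) = 0 & to_curve kr ks (rel_ss ks) = 0].
Proof.
split; apply: to_curve_ideal; apply/asboolP.
- by exists 1, 0, 0; rewrite mul1r !mul0r !addr0.
- by exists 0, 1, 0; rewrite mul1r !mul0r addr0 add0r.
- by exists 0, 0, 1; rewrite mul1r !mul0r !add0r.
Qed.

Lemma yr_yr : yr * yr = ys * ofx kr :> A.
Proof.
have [+ _ _] := to_curve_rels; rewrite rmorphB rmorphXn rmorphM /= in_x_curve.
by move/subr0_eq; rewrite expr2.
Qed.

Lemma yr_ys : yr * ys = ofx kr * ofx ks :> A.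
Proof.
have [_ + _] := to_curve_rels; rewrite rmorphB !rmorphM /= !in_x_curve.
by move/subr0_eq.
Qed.

Lemma ys_ys : ys * ys = yr * ofx ks :> A.
Proof.
have [_ _ +] := to_curve_rels; rewrite rmorphB rmorphXn rmorphM /= in_x_curve.
by move/subr0_eq; rewrite expr2.
Qed.

Lemma mpoly3_ind (Q : {mpoly C[3]} -> Prop) :
  (forall c, Q c%:MP) -> (forall i, Q 'X_i) ->
  (forall p q, Q p -> Q q -> Q (p + q)) ->
  (forall p q, Q p -> Q q -> Q (p * q)) -> forall p, Q p.
Proof.
move=> QC QX QD QM; have Q1 : Q 1 by rewrite -mpolyC1.
apply: mpolyind => [|c m p _ _ Qp]; first by rewrite -mpolyC0.
apply: QD => //; rewrite -mul_mpolyC; apply: (QM) => //.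
rewrite mpolyXE_id; apply: big_rec => // i q _ Qq; apply: (QM) => //.
by elim: (m i) => // n IHn; rewrite exprS; apply: QM.
Qed.

Lemma ord3_inord (i : 'I_3) : [\/ i = inord 0, i = inord 1 | i = inord 2].
Proof.
case: i => [[|[|[|//]]] h]; [apply: Or31|apply: Or32|apply: Or33];
  by apply/val_inj; rewrite /= inordK.
Qed.

Lemma curve_ind (Q : A -> Prop) :
  (forall c, Q (cst c)) -> Q xx -> Q yr -> Q ys ->
  (forall p q, Q p -> Q q -> Q (p + q)) ->
  (forall p q, Q p -> Q q -> Q (p * q)) -> forall a, Q a.
Proof.
move=> QC Qx Qr Qs QD QM a; have [p ->] := to_curveK a.
elim/mpoly3_ind: p => [c|i|p q|p q].
- exact: QC.
- by case: (ord3_inord i) => ->.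
- by rewrite rmorphD; apply: QD.
- by rewrite rmorphM; apply: QM.
Qed.

(** The relations rewrite every product of two of y_r, y_s, so 1, y_r, y_s generate R as a
    C[x]-module. *)
Lemma curve_span (a : A) :
  exists p q t, a = ofx p + ofx q * yr + ofx t * ys.
Proof.
elim/curve_ind: a => [c||||_ _ [p [q [t ->]]] [p' [q' [t' ->]]]|
                     _ _ [p [q [t ->]]] [p' [q' [t' ->]]]].
- by exists c%:P, 0, 0; rewrite ofxC rmorph0 !mul0r !addr0.
- by exists 'X, 0, 0; rewrite ofxX rmorph0 !mul0r !addr0.
- by exists 0, 1, 0; rewrite rmorph1 rmorph0 mul0r mul1r addr0 add0r.
- by exists 0, 0, 1; rewrite rmorph1 rmorph0 mul0r mul1r !add0r.
- by exists (p + p'), (q + q'), (t + t'); rewrite !rmorphD; ring.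
- exists (p * p' + (q * t' + t * q') * (kr * ks)),
         (p * q' + q * p' + t * t' * ks), (p * t' + t * p' + q * q' * kr).
  rewrite !(rmorphD, rmorphM) /=.
  transitivity (ofx p * ofx p' + (ofx q * ofx t' + ofx t * ofx q') * (yr * ys)
    + (ofx p * ofx q' + ofx q * ofx p') * yr + ofx t * ofx t' * (ys * ys)
    + (ofx p * ofx t' + ofx t * ofx p') * ys + ofx q * ofx q' * (yr * yr)).
    by ring.
  by rewrite yr_ys ys_ys yr_yr; ring.
Qed.

(** Evaluation at [h] is taken on representatives; changing the representative adds a combination of
    the relations, which vanishes at [h]. *)
Lemma point_at (h : 'I_3 -> C) :
  (rel_rr kr).@[h] = 0 -> (rel_rs kr ks).@[h] = 0 -> (rel_ss ks).@[h] = 0 ->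
  exists P : {rmorphism A -> C}, forall p, P (to_curve kr ks p) = p.@[h].
Proof.
move=> h1 h2 h3; pose f (a : A) := (repr a).@[h].
have fE p : f (to_curve kr ks p) = p.@[h].
  have : to_curve kr ks (repr (to_curve kr ks p)) = to_curve kr ks p.
    by rewrite /to_curve reprK.
  move/to_curve_eq/asboolP => [u1 [u2 [u3]]].
  move: (rel_rr kr) (rel_rs kr ks) (rel_ss ks) h1 h2 h3 => p1 p2 p3 h1 h2 h3.
  move/(congr1 (meval h)); rewrite mevalB !(mevalD, mevalM) h1 h2 h3.
  by rewrite !mulr0 !addr0 => /subr0_eq.
have fB : zmod_morphism f.
  move=> a b; have [p ->] := to_curveK a; have [q ->] := to_curveK b.
  by rewrite -rmorphB !fE mevalB.
have fM : monoid_morphism f.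
  split=> [|a b]; first by rewrite -(rmorph1 (to_curve kr ks)) fE meval1.
  have [p ->] := to_curveK a; have [q ->] := to_curveK b.
  by rewrite -rmorphM !fE mevalM.
pose P : {rmorphism A -> C} := HB.pack f
  (GRing.isZmodMorphism.Build _ _ f fB) (GRing.isMonoidMorphism.Build _ _ f fM).
by exists P; apply: fE.
Qed.

Lemma exists_closed_point : exists P : {rmorphism A -> C}, closed_point P.
Proof.
have [h [h1 h2 h3]] := curve_has_point kr ks.
have [P PE] := point_at h1 h2 h3; exists P => c.
by rewrite /cst PE mevalC.
Qed.

Lemma closed_point_ofx (P : {rmorphism A -> C}) p :
  closed_point P -> P (ofx p) = p.[P xx].
Proof.
move=> hP; rewrite /ofx -horner_map -map_poly_comp map_poly_id //.
by move=> c _; apply: hP.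
Qed.

End CurveAlgebra.

Lemma size_mul_pred (R : idomainType) (u w : {poly R}) : u != 0 -> w != 0 ->
  (size (u * w)).-1 = ((size u).-1 + (size w).-1)%N.
Proof.
move=> u0 w0; rewrite size_mul //; move: u0 w0; rewrite -!size_poly_gt0.
by case: (size u) => [//|m] _; case: (size w) => [//|n] _; rewrite addSn addnS.
Qed.

(** * Ideals as predicates, and adjoining one element to a proper ideal *)

Section Ideals.
Variables (A : comNzRingType) (C : closedFieldType) (sc : {rmorphism C -> A}).

Definition is_ideal (J : A -> Prop) : Prop :=
  [/\ J 0, forall a b, J a -> J b -> J (a + b) & forall a b, J b -> J (a * b)].

Definition adjoin (J : A -> Prop) (u : A) (a : A) : Prop :=
  exists j k, J j /\ a = j + k * u.

Lemma adjoin_ideal J u : is_ideal J -> is_ideal (adjoin J u).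
Proof.
move=> [J0 JD JM]; split=> [|_ _ [j [k [Jj ->]]] [j' [k' [Jj' ->]]]|
                            a _ [j [k [Jj ->]]]].
- by exists 0, 0; rewrite mul0r addr0.
- by exists (j + j'), (k + k'); split; [apply: JD|rewrite mulrDl addrACA].
- by exists (a * j), (a * k); split; [apply: JM|rewrite mulrDr mulrA].
Qed.

Lemma adjoin_sub J u a : J a -> adjoin J u a.
Proof. by move=> Ja; exists a, 0; rewrite mul0r addr0. Qed.

Lemma adjoin_gen J u : is_ideal J -> adjoin J u u.
Proof. by case=> J0 _ _; exists 0, 1; rewrite mul1r add0r. Qed.

(** Up to a unit, q(u) is a product of factors u - c. If 1 = j + k (u - c) with j in J, multiplying
    by the other factors puts their product in J; if this happened for every factor, 1 would end up
    in J. *)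
Lemma adjoin_root_proper J u (q : {poly C}) :
  is_ideal J -> ~ J 1 -> q != 0 -> J (map_poly sc q).[u] ->
  exists c, ~ adjoin J (u - sc c) 1.
Proof.
move=> [J0 JD JM] J1 q0; have [cs qE] := closed_field_poly_normal q.
rewrite qE map_polyZ rmorph_prod hornerZ horner_prod => /(JM (sc (lead_coef q)^-1)).
rewrite mulrA -rmorphM mulVf ?lead_coef_eq0 // rmorph1 mul1r.
under eq_bigr do rewrite rmorphB /= map_polyX map_polyC hornerXsubC.
elim: cs {qE} => [|c cs IH]; first by rewrite big_nil.
rewrite big_cons => Jc.
have [h|/contrapT [j [k [Jj E]]]] := EM (~ adjoin J (u - sc c) 1).
  by exists c.
apply: IH; rewrite -[X in J X]mul1r {1}E mulrDl; apply: JD.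
  by rewrite mulrC; apply: JM.
by rewrite -mulrA; apply: JM.
Qed.

End Ideals.

(** * Existence of closed points, and norms to C[x] *)

Section Points.
Variables (C : numClosedFieldType) (kr ks : {poly C}).
Local Notation A := (curve_ring kr ks).

(* Adjoining x - x0, y_r - y1 and y_s - y2 successively to a proper ideal that
   contains a nonzero polynomial in x keeps it proper for suitable constants. *)
Lemma weak_nullstellensatz (J : A -> Prop) (p : {poly C}) :
  is_ideal J -> ~ J 1 -> p != 0 -> J (ofx kr ks p) ->
  exists P : {rmorphism A -> C}, closed_point P /\ forall a, J a -> P a = 0.
Proof.
move=> iJ J1 p0 Jp; set sc : {rmorphism C -> A} := @cst C kr ks.
have [x0 J1' {J1}] := adjoin_root_proper iJ J1 p0 Jp.
set J' := adjoin J _ in J1'; have iJ' : is_ideal J' by apply: adjoin_ideal.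
have J'x k : J' (ofx kr ks k - sc k.[x0]).
  have /factor_theorem [q qE] : root (k - k.[x0]%:P) x0.
    by rewrite /root hornerD hornerN hornerC subrr.
  rewrite -[sc _](@ofxC _ kr ks) -rmorphB /= qE rmorphM; case: iJ' => _ _; apply.
  by rewrite rmorphB /= ofxX ofxC; apply: adjoin_gen.
have yr3 : yr ^+ 3 = ofx kr ks (kr ^+ 2 * ks).
  by rewrite !exprS expr0 mulr1 yr_yr mulrA yr_ys !rmorphM /=; ring.
have ys3 : ys ^+ 3 = ofx kr ks (kr * ks ^+ 2).
  by rewrite !exprS expr0 mulr1 ys_ys mulrA [ys * yr]mulrC yr_ys !rmorphM /=; ring.
(* Modulo x - x0, y_r is a root of the monic, hence nonzero, cubic X^3 - (k_r^2 k_s)(x0). *)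
have [||y1 J1''] := @adjoin_root_proper A C sc J' yr
  ('X^3 - (kr ^+ 2 * ks).[x0]%:P) iJ' J1'.
- by rewrite -size_poly_gt0 size_polyDl size_polyXn // size_polyN size_polyC;
    case: (_ != 0).
- rewrite rmorphB /= map_polyXn map_polyC hornerD hornerN hornerC hornerXn /=.
  by rewrite yr3; apply: J'x.
set J'' := adjoin J' _ in J1''; have iJ'' : is_ideal J'' by apply: adjoin_ideal.
have [||y2 J1'''] := @adjoin_root_proper A C sc J'' ys
  ('X^3 - (kr * ks ^+ 2).[x0]%:P) iJ'' J1''.
- by rewrite -size_poly_gt0 size_polyDl size_polyXn // size_polyN size_polyC;
    case: (_ != 0).
- rewrite rmorphB /= map_polyXn map_polyC hornerD hornerN hornerC hornerXn /=.
  by rewrite ys3; apply: adjoin_sub; apply: J'x.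
set J3 := adjoin J'' _ in J1'''; have iJ3 : is_ideal J3 by apply: adjoin_ideal.
have [J0 JD JM] := iJ3.
pose h (i : 'I_3) : C := nth 0 [:: x0; y1; y2] i.
have Jh q : J3 (to_curve kr ks q - sc q.@[h]).
  elim/mpoly3_ind: q => [c|i|q1 q2 J1 J2|q1 q2 J1 J2].
  - by rewrite mevalC subrr.
  - rewrite mevalXU /h; case: (ord3_inord i) => ->; rewrite inordK //=.
    + by do 2!apply: adjoin_sub; apply: adjoin_gen.
    + by apply: adjoin_sub; apply: adjoin_gen.
    + exact: adjoin_gen.
  - by rewrite mevalD !rmorphD opprD addrACA; apply: JD.
  - rewrite mevalM !rmorphM /=.
    have -> : to_curve kr ks q1 * to_curve kr ks q2 - sc q1.@[h] * sc q2.@[h] =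
       to_curve kr ks q2 * (to_curve kr ks q1 - sc q1.@[h]) +
       sc q1.@[h] * (to_curve kr ks q2 - sc q2.@[h]) by ring.
    by apply: JD; apply: (JM).
(* A proper ideal contains no nonzero constant, so by [Jh] whatever lies in [J3] vanishes at [h].
   For the relations this makes [h] a point of the curve. *)
have Jconst c : J3 (sc c) -> c = 0.
  move=> Jc; apply/eqP/negPn/negP => c0; apply: J1'''.
  by rewrite -(rmorph1 sc) -(mulVf c0) rmorphM; apply: JM.
have eval0 q : to_curve kr ks q = 0 -> q.@[h] = 0.
  move=> q0; apply: Jconst; have := JM (-1) _ (Jh q).
  by rewrite q0 sub0r mulN1r opprK.
have [h1 h2 h3] := to_curve_rels kr ks.
have [P PE] := point_at (eval0 _ h1) (eval0 _ h2) (eval0 _ h3).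
exists P; split=> [c|a Ja]; first by rewrite /cst PE mevalC.
have [q qE] := to_curveK a; rewrite qE PE; apply: Jconst.
have := JD _ _ (JM (-1) _ (Jh q)) (adjoin_sub _ (adjoin_sub _ (adjoin_sub _ Ja))).
by rewrite qE mulN1r opprB subrK.
Qed.

(* The norm from C(x, y_r) to C(x), a product of three conjugates, written
   out for p + q y_r + t y_s. *)
Lemma curve_norm (p q t : {poly C}) :
  let N := p ^+ 3 + q ^+ 3 * (kr ^+ 2 * ks) + t ^+ 3 * (kr * ks ^+ 2)
           - p * q * t * (kr * ks) *+ 3 in
  (ofx kr ks p + ofx kr ks q * yr + ofx kr ks t * ys) *
  (ofx kr ks (p ^+ 2 - q * t * (kr * ks)) + ofx kr ks (t ^+ 2 * ks - p * q) * yr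
   + ofx kr ks (q ^+ 2 * kr - p * t) * ys) = ofx kr ks N.
Proof.
rewrite /= !(rmorphD, rmorphB, rmorphMn, rmorphM, rmorphXn) /=.
set R := ofx kr ks kr; set S := ofx kr ks ks.
set P := ofx _ _ p; set Q := ofx _ _ q; set T := ofx _ _ t.
have E1 := yr_yr kr ks; have E2 := yr_ys kr ks; have E3 := ys_ys kr ks.
rewrite -/R -/S in E1 E2 E3.
pose a1 := P ^+ 2 - Q * T * (R * S).
pose a2 := T ^+ 2 * S - P * Q.
pose a3 := Q ^+ 2 * R - P * T.
transitivity (P * a1 + (P * a2 + Q * a1) * yr + (P * a3 + T * a1) * ys
   + Q * a2 * (yr * yr) + T * a3 * (ys * ys) + (Q * a3 + T * a2) * (yr * ys)).
  by rewrite /a1 /a2 /a3; ring.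
by rewrite E1 E2 E3 /a1 /a2 /a3; ring.
Qed.

(** The three equations make the cofactor of [curve_norm] zero. If p is nonzero, comparing degrees
    yields 3 deg p = 3 deg q + 2r + s, so r and s agree mod 3. *)
Lemma norm_cofactor_neq0 (p q t : {poly C}) :
  kr != 0 -> ks != 0 -> (size kr).-1 <> (size ks).-1 %[mod 3] ->
  p ^+ 2 - q * t * (kr * ks) = 0 -> t ^+ 2 * ks - p * q = 0 ->
  q ^+ 2 * kr - p * t = 0 -> [/\ p = 0, q = 0 & t = 0].
Proof.
move=> kr0 ks0 h3 /subr0_eq E1 /subr0_eq E2 /subr0_eq E3.
have [p0|p0] := eqVneq p 0.
  move: E2 E3; rewrite p0 !mul0r => /eqP; rewrite mulf_eq0 (negPf ks0) orbF.
  rewrite expf_eq0 /= => /eqP -> /eqP; rewrite mulf_eq0 (negPf kr0) orbF.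
  by rewrite expf_eq0 /= => /eqP ->.
have := expf_neq0 2 p0; rewrite E1 !mulf_eq0 !negb_or.
move=> /andP [/andP [q0 t0] _].
have {}E1 := congr1 (fun u : {poly C} => (size u).-1) E1.
have {}E2 := congr1 (fun u : {poly C} => (size u).-1) E2.
have {}E3 := congr1 (fun u : {poly C} => (size u).-1) E3.
move: E1 E2 E3; rewrite !expr2 !size_mul_pred ?mulf_neq0 // => E1 E2 E3; case: h3.
have E : ((size p).-1 * 3 + (size kr).-1
          = ((size q).-1 + (size kr).-1) * 3 + (size ks).-1)%N.
  move: (size p).-1 (size q).-1 (size t).-1 (size kr).-1 (size ks).-1 E1 E2 E3.
  by lia.
by rewrite -(modnMDl (size p).-1) E modnMDl.
Qed.

End Points.

(* The weights of x^a y_r, x^a y_s and x^a y_r y_s. *)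
Definition hat_weight (r s n : nat) : Prop := exists a : nat,
  [\/ n = 3 * a + (2 * r + s), n = 3 * a + (r + 2 * s)
    | n = 3 * a + 3 * (r + s)]%N.

(** This is the genus count. The third family starts at 3(r+s), beyond the bound, and the other two
    are disjoint because 2r+s and r+2s differ mod 3. *)
Lemma hat_weights_below r s : r <> s %[mod 3] -> exists L : seq nat,
  [/\ uniq L, size L = (r + s - 1)%N
    & forall n, n \in L <-> hat_weight r s n /\ (n < 3 * (r + s) - 3)%N].
Proof.
move=> h3.
pose f (c a : nat) := (3 * a + c)%N.
have finj c : injective (f c) by move=> a1 a2; rewrite /f; lia.
(* [A1] is the number of a with 3a + (2r+s) < 3(r+s) - 3, and [A2] the number for r+2s. As r+2s and
   2r+s have residues 1 and 2 mod 3 in some order, the two roundings lose 1 in total. *)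
pose A1 := ((r + 2 * s - 1) %/ 3)%N; pose A2 := ((2 * r + s - 1) %/ 3)%N.
exists ([seq f (2 * r + s)%N a | a <- iota 0 A1] ++
        [seq f (r + 2 * s)%N a | a <- iota 0 A2]).
split.
- rewrite cat_uniq !map_inj_uniq ?iota_uniq // andbT /=.
  by apply/hasPn => _ /mapP [a1 _ ->]; apply/mapP => -[a2 _]; rewrite /f; lia.
- by rewrite size_cat !size_map !size_iota /A1 /A2; lia.
- move=> n; rewrite mem_cat; split=> [/orP [] /mapP [a]|[[a []] -> h]].
  + rewrite mem_iota /= add0n => ha ->; split; first by exists a; apply: Or31.
    by move: ha; rewrite /A1 /f; lia.
  + rewrite mem_iota /= add0n => ha ->; split; first by exists a; apply: Or32.
    by move: ha; rewrite /A2 /f; lia.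
  + apply/orP; left; apply/mapP; exists a => //.
    by rewrite mem_iota /= add0n /A1; lia.
  + apply/orP; right; apply/mapP; exists a => //.
    by rewrite mem_iota /= add0n /A2; lia.
  + by exfalso; lia.
Qed.

Lemma mderivXU n (i j : 'I_n) (R : comNzRingType) :
  ('X_j : {mpoly R[n]})^`M(i) = (i == j)%:R.
Proof.
rewrite mderivX mnm1E eq_sym; case: eqVneq => [->|_]; last by rewrite scale0r.
have -> : (U_(j) - U_(j) = 0 :> 'X_{1..n})%MM.
  by apply/mnmP => l; rewrite mnmBE subnn mnm0E.
by rewrite scale1r mpolyX0.
Qed.

Lemma sum_iota (V : nmodType) n (F : nat -> V) :
  \sum_(i <- iota 0 n) F i = \sum_(i < n) F i.
Proof. by rewrite -(big_mkord xpredT) /index_iota subn0. Qed.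

(** * The function field and its place at infinity *)

Section FunctionField.
Variables (C : numClosedFieldType) (kr ks : {poly C}).
Local Notation A := (curve_ring kr ks).
Variables (K : fieldType) (io : {rmorphism A -> K}).

HB.instance Definition _ := GRing.RMorphism.copy (cstK io)
  (io \o @cst C kr ks).

Local Notation sc := (cstK io).
Local Notation X := (io xx).
Local Notation Y := (io yr).
Local Notation Z := (io ys).
Local Notation pX p := (io (ofx kr ks p)).
Local Notation r := (size kr).-1.
Local Notation s := (size ks).-1.

Hypothesis hK : is_fraction_field io.
Hypotheses (kr0 : kr != 0) (ks0 : ks != 0).
Hypothesis (h3 : r <> s %[mod 3]).

Lemma pXE p : pX p = (map_poly sc p).[X].
Proof. by rewrite /ofx -horner_map -map_poly_comp. Qed.

Lemma pX_coef n (p : {poly C}) : (size p <= n)%N ->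
  pX p = \sum_(i < n) sc p`_i * X ^+ i.
Proof.
move=> pn; rewrite pXE (@horner_coef_wide _ n); last by rewrite size_map_poly.
by apply: eq_bigr => i _; rewrite coef_map.
Qed.

Lemma Y_Y : Y * Y = Z * pX kr.
Proof. by have := congr1 io (yr_yr kr ks); rewrite !rmorphM. Qed.
Lemma Y_Z : Y * Z = pX kr * pX ks.
Proof. by have := congr1 io (yr_ys kr ks); rewrite !rmorphM. Qed.
Lemma Z_Z : Z * Z = Y * pX ks.
Proof. by have := congr1 io (ys_ys kr ks); rewrite !rmorphM. Qed.

Lemma Y_cube : Y ^+ 3 = pX (kr ^+ 2 * ks).
Proof.
by rewrite !exprS expr0 mulr1 Y_Y mulrA Y_Z !rmorphM /=; ring.
Qed.

Lemma Z_cube : Z ^+ 3 = pX (kr * ks ^+ 2).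
Proof.
by rewrite !exprS expr0 mulr1 Z_Z mulrA [Z * Y]mulrC Y_Z !rmorphM /=; ring.
Qed.

Lemma three_neq0 : 3%:R != 0 :> K.
Proof. by rewrite -(rmorph_nat sc) fmorph_eq0 pnatr_eq0. Qed.

(** * Orders of monomials at infinity, and the residue field *)

Section Infinity.
Variable v : K -> int.
Hypothesis hv : is_order_at_infinity io v.

Let hvn : is_normalized_valuation sc v := hv.1.

(** If x had no pole, neither would y_r and y_s, whose cubes are polynomials in x. Then no element
    of R would have one. *)
Lemma val_X_lt0 : X != 0 /\ v X < 0.
Proof.
have [X0|X0] := EM (val_ge v 0 X); last first.
  have Xn0 : X != 0 by apply/eqP => X0'; apply: X0; left.
  by split=> //; rewrite ltNge; apply/negP => h; apply: X0; right.
have [_ [f []]] := hv.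
have pXO p : val_ge v 0 (pX p).
  rewrite (pX_coef (leqnn _)); apply: (val_ge_sum hvn) => i _.
  by apply: (val_geMl hvn); apply: (val_geX hvn).
have MO f1 f2 : val_ge v 0 f1 -> val_ge v 0 f2 -> val_ge v 0 (f1 * f2).
  by move=> h1 h2; have := val_geM hvn h1 h2; rewrite addr0.
elim/curve_ind: f => [c||||p q hp hq|p q hp hq] //.
- exact: (val_ge_const hvn).
- by apply: (val_ge_root hvn (n := 3)) => //; rewrite Y_cube.
- by apply: (val_ge_root hvn (n := 3)) => //; rewrite Z_cube.
- by rewrite rmorphD; apply: (val_geD hvn).
- by rewrite rmorphM; apply: MO.
Qed.

(** Powers of x have distinct orders, and since v(x) < 0 the least one belongs to the top degree. *)
Lemma val_pX (p : {poly C}) : p != 0 -> pX p != 0 /\ v (pX p) = v X *+ (size p).-1.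
Proof.
move=> p0; have [X0 vX] := val_X_lt0.
have [||||i [+ _] [+ + _ imin]] :=
  @val_lead _ _ _ _ hvn nat (iota 0 (size p)) (fun i => X ^+ i) (fun i => p`_i).
- exact: iota_uniq.
- by move=> i _; apply: expf_neq0.
- by move=> i j _ _ /=; rewrite !(valXn hvn) //; apply: mulrIn; rewrite ltr0_neq0.
- exists (size p).-1; last by rewrite -lead_coefE lead_coef_eq0.
  by rewrite mem_iota prednK ?size_poly_gt0 /=.
rewrite mem_iota sum_iota -(pX_coef (leqnn _)).
move=> /andP [_ ip] pX0 ->; split=> //; rewrite (valXn hvn) //.
have := imin (size p).-1; rewrite mem_iota !(valXn hvn) // prednK ?size_poly_gt0 //=.
rewrite add0n leqnn -lead_coefE lead_coef_eq0 => /(_ erefl p0) le_i.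
have ile : (i <= (size p).-1)%N by rewrite -ltnS prednK ?size_poly_gt0.
move: le_i; rewrite ler_nMn2l // => le_i.
by congr (_ *+ _); apply/eqP; rewrite eqn_leq ile.
Qed.

Lemma Y_neq0 : Y != 0.
Proof.
have := (val_pX (mulf_neq0 (expf_neq0 2 kr0) ks0)).1.
by rewrite -Y_cube expf_eq0.
Qed.

Lemma Z_neq0 : Z != 0.
Proof.
have := (val_pX (mulf_neq0 kr0 (expf_neq0 2 ks0))).1.
by rewrite -Z_cube expf_eq0.
Qed.

Definition gen_weight (j : nat) : nat := nth 0%N [:: 0; 2 * r + s; r + 2 * s]%N j.

Definition mono (k : nat * nat) : K := X ^+ k.1 * nth 0 [:: 1; Y; Z] k.2.

(** Before v(x) is known, the cubes of y_r and y_s determine only three times their orders, as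
    multiples of v(x). *)
Lemma mono_val k : (k.2 < 3)%N -> mono k != 0 /\
  v (mono k) *+ 3 = v X *+ (3 * k.1 + gen_weight k.2).
Proof.
have [X0 _] := val_X_lt0.
have vY : v Y *+ 3 = v X *+ (2 * r + s).
  rewrite -(valXn hvn) ?Y_neq0 // Y_cube (val_pX _).2 ?expr2 ?mulf_neq0 //.
  by rewrite !size_mul_pred ?mulf_neq0 // addnn mul2n.
have vZ : v Z *+ 3 = v X *+ (r + 2 * s).
  rewrite -(valXn hvn) ?Z_neq0 // Z_cube (val_pX _).2 ?expr2 ?mulf_neq0 //.
  by rewrite !size_mul_pred ?mulf_neq0 // addnn mul2n.
case: k => i j /= j3; rewrite /mono /=.
have g0 : nth 0 [:: 1; Y; Z] j != 0.
  by case: j j3 => [|[|[|//]]] _ /=; rewrite ?oner_eq0 ?Y_neq0 ?Z_neq0.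
split; first by rewrite mulf_neq0 ?expf_neq0.
rewrite (valM hvn) ?expf_neq0 // (valXn hvn) // mulrnDl mulrnDr -mulrnA mulnC.
congr (_ + _); case: j {g0} j3 => [|[|[|//]]] _ //=.
by rewrite (val1 hvn) mul0rn.
Qed.

(** The weights 0, 2r+s and r+2s are pairwise distinct mod 3, because r and s are. *)
Lemma mono_val_inj k k' : (k.2 < 3)%N -> (k'.2 < 3)%N ->
  v (mono k) = v (mono k') -> k = k'.
Proof.
move=> k3 k3' E; have [_ vX] := val_X_lt0.
have := (mono_val k3).2; rewrite E (mono_val k3').2 => E'.
have {E'} : (3 * k.1 + gen_weight k.2 = 3 * k'.1 + gen_weight k'.2)%N.
  by apply/esym; move: E'; apply: mulrIn; rewrite ltr0_neq0.
case: k k' k3 k3' {E} => [i j] [i' j'] /= j3 j3'; rewrite /gen_weight.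
have rs : ((size kr).-1 %% 3 <> (size ks).-1 %% 3)%N := h3.
move: (size kr).-1 (size ks).-1 rs => R S rs E.
case: j j' j3 j3' E => [|[|[|//]]] [|[|[|//]]] _ _ /= E;
  try (by congr pair; lia); by exfalso; lia.
Qed.

Definition mono_index n : seq (nat * nat) :=
  [seq (i, j) | i <- iota 0 n, j <- [:: 0; 1; 2]%N].

Lemma mono_index_uniq n : uniq (mono_index n).
Proof. by apply: allpairs_uniq => //; [apply: iota_uniq|case=> ? ? []]. Qed.

Lemma mono_index_lt n k : k \in mono_index n -> (k.2 < 3)%N.
Proof. by case/allpairsP => -[i j] [_ /=]; rewrite !inE => /or3P [] /eqP -> ->. Qed.

Lemma mono_expand a : exists n (c : nat * nat -> C),
  io a = \sum_(k <- mono_index n) sc (c k) * mono k.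
Proof.
have [p [q [t ->]]] := curve_span a.
pose n := maxn (size p) (maxn (size q) (size t)).
exists n, (fun k => (nth 0 [:: p; q; t] k.2)`_k.1).
rewrite big_allpairs sum_iota.
under eq_bigr do rewrite !big_cons big_nil /mono /= addr0 mulr1 addrA.
rewrite !big_split /= !rmorphD !rmorphM /= !(@pX_coef n) ?leq_max ?leqnn ?orbT //.
by rewrite !mulr_suml; congr (_ + _ + _); apply: eq_bigr => i _; rewrite mulrA.
Qed.

Lemma mono_lead a : io a != 0 -> exists n (c : nat * nat -> C) k,
  [/\ k \in mono_index n, c k != 0, v (io a) = v (mono k),
      val_ge v (v (io a) + 1) (io a - sc (c k) * mono k)
    & io a = \sum_(j <- mono_index n) sc (c j) * mono j /\
      forall j, j \in mono_index n -> c j != 0 -> v (io a) <= v (mono j)].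
Proof.
move=> a0; have [n [c E]] := mono_expand a; exists n, c.
have [|noc] := boolP (has (fun k => c k != 0) (mono_index n)); last first.
  case/eqP: a0; rewrite E big_seq big1 // => k kn.
  have /eqP -> : c k == 0 by apply/negPn/negP => ck; case/hasP: noc; exists k.
  by rewrite rmorph0 mul0r.
move/hasP => hc; have [|||k [kn ck]] :=
  @val_lead _ _ _ _ hvn _ (mono_index n) mono c (mono_index_uniq n).
- by move=> k /mono_index_lt k3; have [] := mono_val k3.
- by move=> k k' /mono_index_lt h1 /mono_index_lt h2; apply: mono_val_inj.
- exact: hc.
by rewrite -E => -[_ vE hge kmin]; exists k; split=> //; rewrite vE.
Qed.

Lemma fraction_neq0 f : f != 0 -> exists a b,
  [/\ io a != 0, io b != 0 & f = io a / io b].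
Proof.
have [inj frac] := hK; have [a [b [b0 ->]]] := frac f.
rewrite mulf_eq0 negb_or => /andP [a0 _]; exists a, b; split=> //.
by rewrite -(rmorph0 io) (inj_eq inj).
Qed.

(** An element of order 1 is a quotient of two elements of R. Three times the order of each is an
    integer multiple of v(x), so v(x) divides 3. *)
Lemma val_X : v X = -3%:Z.
Proof.
have [X0 vX] := val_X_lt0; have [_ _ _ /(_ 1) [f f0 vf]] := hvn.
have [a [b [a0 b0 fE]]] := fraction_neq0 f0.
move: vf; rewrite fE (valM hvn) ?invr_eq0 // (valV hvn) //.
have [n [c [k [/mono_index_lt k3 _ -> _ _]]]] := mono_lead a0.
have [n' [c' [k' [/mono_index_lt k3' _ -> _ _]]]] := mono_lead b0.
have := (@mono_val (0, 1)%N erefl).2; rewrite /gen_weight /=.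
have := (mono_val k3').2; have := (mono_val k3).2.
move: (gen_weight k.2) (gen_weight k'.2) => w w'.
have rs : ((size kr).-1 %% 3 <> (size ks).-1 %% 3)%N := h3.
move: (size kr).-1 (size ks).-1 rs => R S rs.
have natM (x : int) (l : nat) : x *+ l = x * l%:Z by rewrite -mulr_natr natz.
rewrite !natM.
move: (v _) (v _) (v _) (v X) vX => vy v2 v1 x x0 E E' Ey vf.
have xd : x * ((3 * k.1 + w)%N%:Z - (3 * k'.1 + w')%N%:Z) = 3.
  by rewrite mulrBr -E -E' -mulrBl vf.
have x3 : - 3%:Z <= x.
  move: (_ - _) xd => d xd; have [d0|d0] := lerP 0 d.
    by have := mulr_le0_ge0 (ltW x0) d0; rewrite xd.
  have : x * (d + 1) >= 0 by apply: mulr_le0; lia.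
  by rewrite mulrDr xd mulr1; lia.
(* The value -1 contradicts 3 v(y_r) = (2r+s) v(x), as 3 does not divide 2r+s; and -2 does not
   divide 3. *)
have : x = -1 \/ x = - 2%:Z \/ x = -3%:Z by lia.
by case=> [xE|[xE|//]]; exfalso; move: Ey xd; rewrite xE; lia.
Qed.

Lemma mono_valE k : (k.2 < 3)%N ->
  v (mono k) = - (3 * k.1 + gen_weight k.2)%N%:Z.
Proof. by move=> k3; have := (mono_val k3).2; rewrite val_X; lia. Qed.

Lemma val_Y : v Y = - (2 * r + s)%N%:Z.
Proof. by have := @mono_valE (0, 1)%N erefl; rewrite /mono expr0 mul1r. Qed.

Lemma val_Z : v Z = - (r + 2 * s)%N%:Z.
Proof. by have := @mono_valE (0, 2)%N erefl; rewrite /mono expr0 mul1r. Qed.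

(** Numerator and denominator of a unit have equal order, hence the same leading monomial; the
    residue is the ratio of their leading coefficients. *)
Lemma residue f : f != 0 -> v f = 0 -> exists c, val_ge v 1 (f - sc c).
Proof.
move=> f0; have [a [b [a0 b0 ->]]] := fraction_neq0 f0.
rewrite (valM hvn) ?invr_eq0 // (valV hvn) // => /subr0_eq vab.
have [n [c [k [/mono_index_lt k3 ck vk ak _]]]] := mono_lead a0.
have [n' [c' [k' [/mono_index_lt k3' ck' vk' bk' _]]]] := mono_lead b0.
have kk' : k' = k by apply: mono_val_inj => //; rewrite -vk -vk'.
move: ck' bk'; rewrite {}kk' -vab => ck' bk'; exists (c k / c' k).
have : val_ge v (v (io a) + 1) (io a - sc (c k / c' k) * io b).
  have -> : io a - sc (c k / c' k) * io b = io a - sc (c k) * mono k -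
      sc (c k / c' k) * (io b - sc (c' k) * mono k).
    rewrite mulrBr !mulrA -rmorphM divfK //; ring.
  by apply: (val_geB hvn) ak _; apply: (val_geMl hvn) bk'.
have bV : val_ge v (- v (io b)) (io b)^-1 by right; rewrite (valV hvn).
by move=> /(fun h => val_geM hvn h bV); rewrite mulrBl mulfK // vab
  addrAC subrr add0r.
Qed.

Lemma curve_independent p q t :
  pX p + pX q * Y + pX t * Z = 0 -> [/\ p = 0, q = 0 & t = 0].
Proof.
pose n := maxn (size p) (maxn (size q) (size t)).
rewrite !(@pX_coef n) ?leq_max ?leqnn ?orbT // => E.
pose c (k : nat * nat) := (nth 0 [:: p; q; t] k.2)`_k.1.
have S0 : \sum_(k <- mono_index n) sc (c k) * mono k = 0.
  rewrite -[RHS]E big_allpairs sum_iota.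
  under eq_bigr do rewrite !big_cons big_nil /mono /= addr0 mulr1 addrA.
  rewrite !big_split /= !mulr_suml.
  by congr (_ + _ + _); apply: eq_bigr => i _; rewrite mulrA.
have c0 k : k \in mono_index n -> c k = 0.
  apply: (val_independent hvn (mono_index_uniq n) _ _ S0) => [i|i j].
    by move=> /mono_index_lt k3; have [] := mono_val k3.
  by move=> /mono_index_lt h1 /mono_index_lt h2; apply: mono_val_inj.
have p0 j : (j < 3)%N -> nth 0 [:: p; q; t] j = 0.
  move=> j3; apply/polyP => i; rewrite coef0.
  have [ni|ni] := leqP n i; last first.
    apply: (c0 (i, j)); apply/allpairsP; exists (i, j).
    by rewrite mem_iota !inE; split=> //; case: j j3 => [|[|[|]]].
  rewrite nth_default //; apply: leq_trans ni; rewrite !leq_max.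
  by case: j j3 => [|[|[|//]]] _ /=; rewrite leqnn ?orbT.
by split; [apply: (p0 0%N)|apply: (p0 1%N)|apply: (p0 2%N)].
Qed.

(** Supplies the polynomial in x that [weak_nullstellensatz] asks for. A zero norm would make the
    cofactor zero in the field [K], which [norm_cofactor_neq0] rules out. *)
Lemma exists_norm a : io a != 0 ->
  exists b p, p != 0 /\ a * b = ofx kr ks p.
Proof.
have [p [q [t ->]]] := curve_span a => a0; have /= := curve_norm kr ks p q t.
set N := (X in _ = ofx _ _ X); set a' := (X in _ * X = _) => E.
exists a', N; split=> //; apply/eqP => N0.
have := congr1 io E; rewrite N0 rmorph0 rmorphM rmorph0 => /eqP.
rewrite mulf_eq0 (negPf a0) /= /a' !(rmorphD io) !(rmorphM io) /=.
move=> /eqP /curve_independent [E1 E2 E3].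
have [p0 q0 t0] := norm_cofactor_neq0 kr0 ks0 h3 E1 E2 E3.
by move: a0; rewrite p0 q0 t0 !rmorph0 !mul0r !addr0 rmorph0 eqxx.
Qed.

Lemma io_neq0 a : a != 0 -> io a != 0.
Proof. by have [inj _] := hK; rewrite -(rmorph0 io) (inj_eq inj). Qed.

Lemma pX_neq0 (p : {poly C}) : p != 0 -> pX p != 0.
Proof. by move=> p0; have [] := val_pX p0. Qed.

Lemma YZ_neq0 : Y * Z != 0.
Proof. by rewrite mulf_neq0 ?Y_neq0 ?Z_neq0. Qed.

(** * The derivation d/dx of the function field *)

Lemma derivation_pX (M : lmodType K) (D : K -> M) (p : {poly C}) :
  is_derivation sc D -> D (pX p) = pX p^`() *: D X.
Proof.
move=> [DD DM DC]; rewrite !pXE.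
exact: (@derivation_horner C K K sc idfun M D p X).
Qed.

Lemma derivation_cube (M : lmodType K) (D : K -> M) f :
  is_derivation sc D -> D (f ^+ 3) = (3%:R * f ^+ 2) *: D f.
Proof.
move=> [_ DM _]; rewrite !exprS expr0 mulr1 !DM scalerDr !scalerA -!scalerDl.
by congr (_ *: _); ring.
Qed.

(** A derivation nonzero on x is what later shows, by the universal property, that dx is nonzero in
    [Omega]. *)
Lemma exists_del : exists del : K -> K,
  is_derivation sc (del : K -> K^o) /\ del X = 1.
Proof.
pose R := pX kr; pose S := pX ks; pose R' := pX kr^`(); pose S' := pX ks^`().
have R0 : R != 0 by apply: pX_neq0.
have S0 : S != 0 by apply: pX_neq0.
(* logarithmic derivatives of y_r^3 = k_r^2 k_s and y_s^3 = k_r k_s^2 *)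
pose DY := Y * (R' / R *+ 2 + S' / S) / 3%:R.
pose DZ := Z * (R' / R + S' / S *+ 2) / 3%:R.
pose ev (p : {mpoly C[3]}) : K := io (to_curve kr ks p).
(* The chain rule with the values forced on x, y_r and y_s. It descends to R once it kills the three
   relations. *)
pose D0 (p : {mpoly C[3]}) : K := ev p^`M(inord 0) + ev p^`M(inord 1) * DY
                                  + ev p^`M(inord 2) * DZ.
have evD p q : ev (p + q) = ev p + ev q by rewrite /ev !rmorphD.
have evM p q : ev (p * q) = ev p * ev q by rewrite /ev !rmorphM.
have D0D p q : D0 (p + q) = D0 p + D0 q.
  by rewrite /D0 !mderivD !evD; ring.
have D0M p q : D0 (p * q) = ev p * D0 q + ev q * D0 p.
  by rewrite /D0 !mderivM !evD !evM; ring.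
have ev0 : ev 0 = 0 by rewrite /ev !rmorph0.
have ev1 : ev 1 = 1 by rewrite /ev !rmorph1.
have D0C c : D0 c%:MP = 0.
  by rewrite /D0 !mderivC ev0 !mul0r !addr0.
have i01 : inord 0 == inord 1 :> 'I_3 = false by rewrite -val_eqE /= !inordK.
have i02 : inord 0 == inord 2 :> 'I_3 = false by rewrite -val_eqE /= !inordK.
have i12 : inord 1 == inord 2 :> 'I_3 = false by rewrite -val_eqE /= !inordK.
have D0x : D0 'X_(inord 0) = 1.
  rewrite /D0 !mderivXU eqxx !(eq_sym _ (inord 0)) i01 i02 ev0 ev1.
  by rewrite !mul0r !addr0.
have D0y : D0 'X_(inord 1) = DY.
  rewrite /D0 !mderivXU eqxx i01 (eq_sym (inord 2)) i12 ev0 ev1.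
  by rewrite !mul0r addr0 add0r mul1r.
have D0z : D0 'X_(inord 2) = DZ.
  by rewrite /D0 !mderivXU eqxx i02 i12 ev0 ev1 !mul0r !add0r mul1r.
have D0k k : D0 (in_x k) = pX k^`().
  pose evm : {rmorphism {mpoly C[3]} -> K} := io \o to_curve kr ks.
  have := @derivation_horner C {mpoly C[3]} K (@mpolyC 3 C) evm K^o D0 k
    'X_(inord 0) D0D D0M D0C.
  by rewrite D0x /= => ->; rewrite -in_x_curve; apply: mulr1.
have D0N p : D0 (- p) = - D0 p.
  by rewrite -mulN1r -[- 1]/(- (1%:MP)) -mpolyCN D0M D0C mulr0 addr0 mpolyCN
    /ev !rmorphN !rmorph1 mulN1r.
have evX0 : ev 'X_(inord 1) = Y /\ ev 'X_(inord 2) = Z by [].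
have evk k : ev (in_x k) = pX k by rewrite /ev in_x_curve.
have t0 := three_neq0.
have [h1 h2 h3'] := to_curve_rels kr ks.
have E1 : D0 (rel_rr kr) = 0.
  rewrite /rel_rr D0D D0N expr2 !D0M D0y D0z D0k evk evX0.1 evX0.2.
  rewrite -/R -/R' /DY /DZ.
  have -> : Y * (Y * (R' / R *+ 2 + S' / S) / 3%:R) =
    (Z * R) * (R' / R *+ 2 + S' / S) / 3%:R by rewrite -Y_Y; ring.
  by field; rewrite t0 R0 S0.
have E2 : D0 (rel_rs kr ks) = 0.
  rewrite /rel_rs D0D D0N !D0M D0y D0z !D0k !evk evX0.1 evX0.2.
  rewrite -/R -/R' -/S -/S' /DY /DZ.
  transitivity ((Y * Z) * (R' / R + S' / S) - (R * S' + S * R')).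
    by field; rewrite t0 R0 S0.
  by rewrite Y_Z -/R -/S; field; rewrite R0 S0.
have E3 : D0 (rel_ss ks) = 0.
  rewrite /rel_ss D0D D0N expr2 !D0M D0y D0z D0k evk evX0.1 evX0.2.
  rewrite -/S -/S' /DY /DZ.
  have -> : Z * (Z * (R' / R + S' / S *+ 2) / 3%:R) =
    (Y * S) * (R' / R + S' / S *+ 2) / 3%:R by rewrite -Z_Z; ring.
  by field; rewrite t0 R0 S0.
have DI p : curve_ideal kr ks p -> D0 p = 0.
  move=> /asboolP [u1 [u2 [u3 ->]]]; rewrite !D0D !D0M E1 E2 E3.
  by rewrite /ev h1 h2 h3' rmorph0 !mul0r !mulr0 !addr0.
pose DA (a : A) := D0 (repr a).
have DAE p : DA (to_curve kr ks p) = D0 p.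
  apply/eqP; rewrite -subr_eq0 -D0N -D0D; apply/eqP/DI/to_curve_eq.
  by rewrite /to_curve reprK.
have DAD f g : DA (f + g) = DA f + DA g.
  have [p ->] := to_curveK f; have [q ->] := to_curveK g.
  by rewrite -rmorphD !DAE D0D.
have DAM f g : DA (f * g) = io f * DA g + io g * DA f.
  have [p ->] := to_curveK f; have [q ->] := to_curveK g.
  by rewrite -rmorphM !DAE D0M.
have [del [delE delD delM]] := derivation_extend hK DAD DAM.
exists del; split; first split=> //.
  by move=> c; rewrite delE /cst DAE D0C.
by rewrite delE DAE D0x.
Qed.

Variable del : K -> K.
Hypothesis hdel : is_derivation sc (del : K -> K^o).
Hypothesis delX : del X = 1.

Let delD f g : del (f + g) = del f + del g.
Proof. by case: hdel. Qed.

Let delM f g : del (f * g) = f * del g + g * del f.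
Proof. by case: hdel => _ + _; apply. Qed.

Let delC c : del (sc c) = 0.
Proof. by case: hdel. Qed.

Lemma del0 : del 0 = 0.
Proof. by have := delC 0; rewrite rmorph0. Qed.

Lemma delB f g : del (f - g) = del f - del g.
Proof. by have := delD (f - g) g; rewrite subrK => ->; rewrite addrK. Qed.

Lemma del_div f g : g != 0 -> del (f / g) = g^-1 * del f - f / g ^+ 2 * del g.
Proof. exact: (@derivation_div C K sc K^o del f g hdel). Qed.

Lemma del_pX p : del (pX p) = pX p^`().
Proof. by rewrite (derivation_pX p hdel) delX; apply: mulr1. Qed.

Lemma del_cube f : del (f ^+ 3) = 3%:R * f ^+ 2 * del f.
Proof. exact: (derivation_cube f hdel). Qed.

Lemma del_Y : 3%:R * Y ^+ 2 * del Y = pX (kr ^+ 2 * ks)^`().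
Proof. by rewrite -del_pX -Y_cube del_cube. Qed.

Lemma del_Z : 3%:R * Z ^+ 2 * del Z = pX (kr * ks ^+ 2)^`().
Proof. by rewrite -del_pX -Z_cube del_cube. Qed.

(** On y_r and y_s the formula follows from their cubes, which are polynomials in x, after
    cancelling 3 y_r^2 or 3 y_s^2. Thus dx spans all differentials. *)
Lemma derivation_del (M : lmodType K) (D : K -> M) f :
  is_derivation sc D -> D f = del f *: D X.
Proof.
move=> hD; have [DD DM DC] := hD.
have DA a : D (io a) = del (io a) *: D X.
  elim/curve_ind: a => [c||||p q hp hq|p q hp hq].
  - by rewrite [LHS]DC [X in X *: _]delC scale0r.
  - by rewrite delX scale1r.
  - have Y2 : 3%:R * Y ^+ 2 != 0 by rewrite mulf_neq0 ?three_neq0 ?expf_neq0 ?Y_neq0.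
    apply: (scalerI Y2); rewrite -derivation_cube // Y_cube derivation_pX //.
    by rewrite scalerA del_Y.
  - have Z2 : 3%:R * Z ^+ 2 != 0 by rewrite mulf_neq0 ?three_neq0 ?expf_neq0 ?Z_neq0.
    apply: (scalerI Z2); rewrite -derivation_cube // Z_cube derivation_pX //.
    by rewrite scalerA del_Z.
  - by rewrite rmorphD DD delD scalerDl hp hq.
  - by rewrite rmorphM DM delM scalerDl -!scalerA hp hq.
have [_ frac] := hK; have [a [b [/io_neq0 b0 ->]]] := frac f.
rewrite (derivation_div _ hD b0) (DA a) (DA b) !scalerA -scalerBl.
by congr (_ *: _); rewrite del_div.
Qed.

(** * The ideal (y_r, y_s) of R, seen inside [K], and its localizations *)

Definition hat (f : K) : Prop := exists u w : A, f = io (u * yr + w * ys).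

Lemma hat0 : hat 0.
Proof. by exists 0, 0; rewrite !mul0r addr0 rmorph0. Qed.

Lemma hatD f g : hat f -> hat g -> hat (f + g).
Proof.
move=> [u [w ->]] [u' [w' ->]]; exists (u + u'), (w + w').
by rewrite -rmorphD !mulrDl addrACA.
Qed.

Lemma hatM a f : hat f -> hat (io a * f).
Proof.
move=> [u [w ->]]; exists (a * u), (a * w).
by rewrite -rmorphM mulrDr !mulrA.
Qed.

Lemma hatB f g : hat f -> hat g -> hat (f - g).
Proof. by move=> hf hg; rewrite -mulN1r -(rmorphN1 io); apply/hatD/hatM. Qed.

Lemma hat_Y : hat Y. Proof. by exists 1, 0; rewrite mul1r mul0r addr0. Qed.
Lemma hat_Z : hat Z. Proof. by exists 0, 1; rewrite mul1r mul0r add0r. Qed.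

(** The factor y_r y_s = k_r k_s clears the denominators of the logarithmic derivatives of y_r and
    y_s, leaving polynomial multiples of y_r and y_s. *)
Lemma hat_del a : hat (Y * Z * del (io a)).
Proof.
have t0 := three_neq0; have Y0 := Y_neq0; have Z0 := Z_neq0.
elim/curve_ind: a => [c||||p q hp hq|p q hp hq].
- by rewrite [del _]delC mulr0; apply: hat0.
- by rewrite delX mulr1; apply/hatM/hat_Z.
- have -> : Y * Z * del Y =
      io (cst 3%:R^-1 * ofx kr ks ((kr^`() * ks) *+ 2 + kr * ks^`())) * Y.
    apply: (mulfI (mulf_neq0 t0 (expf_neq0 2 Y0))).
    rewrite mulrCA del_Y Y_Z !rmorphM /= -[io (cst _)]/(sc _) fmorphV rmorph_nat.
    transitivity (Y ^+ 3 * pX (kr^`() * ks *+ 2 + kr * ks^`())); last by field.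
    rewrite Y_cube -!rmorphM; congr (io (ofx _ _ _)).
    by rewrite derivM expr2 derivM; ring.
  exact/hatM/hat_Y.
- have -> : Y * Z * del Z =
      io (cst 3%:R^-1 * ofx kr ks (kr^`() * ks + (kr * ks^`()) *+ 2)) * Z.
    apply: (mulfI (mulf_neq0 t0 (expf_neq0 2 Z0))).
    rewrite mulrCA del_Z Y_Z !rmorphM /= -[io (cst _)]/(sc _) fmorphV rmorph_nat.
    transitivity (Z ^+ 3 * pX (kr^`() * ks + kr * ks^`() *+ 2)); last by field.
    rewrite Z_cube -!rmorphM; congr (io (ofx _ _ _)).
    by rewrite derivM expr2 derivM; ring.
  exact/hatM/hat_Z.
- by rewrite rmorphD delD mulrDr; apply: hatD.
- have -> : Y * Z * del (io (p * q)) =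
    io p * (Y * Z * del (io q)) + io q * (Y * Z * del (io p)).
    by rewrite rmorphM delM; ring.
  by apply: hatD; apply: hatM.
Qed.

(** Membership in the localization at [P] of the ideal (y_r, y_s). *)
Definition local_hat (P : {rmorphism A -> C}) (f : K) : Prop :=
  exists2 b : A, P b != 0 & hat (io b * f).

Lemma point_neq0 (P : {rmorphism A -> C}) b : P b != 0 -> io b != 0.
Proof.
by move=> Pb; apply: io_neq0; apply: contraNneq Pb => ->; rewrite rmorph0.
Qed.

Lemma local_hatD P f g : local_hat P f -> local_hat P g -> local_hat P (f + g).
Proof.
move=> [b Pb hb] [b' Pb' hb']; exists (b * b'); first by rewrite rmorphM mulf_neq0.
rewrite rmorphM mulrDr {1}[io b * _]mulrC -!mulrA.
by apply: hatD; apply: hatM.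
Qed.

Lemma local_hat_del P f g : local_ring io P f -> local_ring io P g ->
  local_hat P (Y * Z * (f * del g)).
Proof.
move=> [a' [b' [Pb' ->]]] [a [b [Pb ->]]].
have b0 := point_neq0 Pb; have b0' := point_neq0 Pb'.
exists (b' * b ^+ 2); first by rewrite rmorphM rmorphXn mulf_neq0 ?expf_neq0.
have -> : io (b' * b ^+ 2) * (Y * Z * (io a' / io b' * del (io a / io b))) =
   io a' * (io b * (Y * Z * del (io a)) - io a * (Y * Z * del (io b))).
  rewrite del_div // rmorphM rmorphXn /=.
  by field; rewrite b0 b0'.
by apply: hatM; apply: hatB; apply/hatM/hat_del.
Qed.

(** The denominators [J] of [f] relative to [hat] form an ideal. If it were proper, it would vanish
    at some closed point, where [f] nevertheless has a nonvanishing denominator. *)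
Lemma hat_of_local f : f != 0 ->
  (forall P : {rmorphism A -> C}, closed_point P -> local_hat P f) -> hat f.
Proof.
move=> f0 hf; pose J a := hat (io a * f).
have iJ : is_ideal J.
  split=> [|a b ha hb|a b hb]; rewrite /J.
  - by rewrite rmorph0 mul0r; apply: hat0.
  - by rewrite rmorphD mulrDl; apply: hatD.
  - by rewrite rmorphM -mulrA; apply: hatM.
apply: contrapT => nf; have [P0 hP0] := exists_closed_point kr ks.
have [b Pb Jb] := hf _ hP0.
(* A denominator at any one point is a nonzero element of [J], and its norm is a polynomial in x
   lying in [J]. *)
have [b' [p [p0 bE]]] := exists_norm (point_neq0 Pb).
have [||P [hP PJ]] := @weak_nullstellensatz _ _ _ J p iJ _ p0.
- by rewrite /J rmorph1 mul1r.
- by rewrite -bE mulrC; case: iJ => _ _; apply.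
by have [c Pc /PJ Pc0] := hf _ hP; rewrite Pc0 eqxx in Pc.
Qed.

(** * Forms regular at the finite points, and at infinity *)

Section Forms.
Variables (Omega : lmodType K) (d : K -> Omega).
Hypothesis hOmega : is_kaehler sc d.

Let hd : is_derivation sc d := hOmega.1.

Lemma dX_neq0 : d X != 0.
Proof.
have [_ /(_ K^o _ hdel) [h [hE _]]] := hOmega.
apply/eqP => dX0; have := hE X; rewrite dX0 linear0 delX => /esym/eqP.
by rewrite oner_eq0.
Qed.

Lemma d_del f : d f = del f *: d X. Proof. exact: derivation_del hd. Qed.

Lemma dX_inj : injective (fun f : K => f *: d X).
Proof.
move=> f g /eqP; rewrite -subr_eq0 -scalerBl scaler_eq0 (negPf dX_neq0) orbF.
by rewrite subr_eq0 => /eqP.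
Qed.

Lemma H0_affine_hat w : H0_affine io d w ->
  exists f, hat f /\ w = (f / (Y * Z)) *: d X.
Proof.
move=> hw; have [P0 hP0] := exists_closed_point kr ks.
have [h wE] : exists h, w = h *: d X.
  have [n [f [g [_ ->]]]] := hw _ hP0; exists (\sum_(i < n) f i * del (g i)).
  by rewrite scaler_suml; apply: eq_bigr => i _; rewrite d_del scalerA.
exists (Y * Z * h); split; last first.
  by rewrite wE; congr (_ *: _); rewrite mulrC mulKf ?YZ_neq0.
have [->|h0] := eqVneq h 0; first by rewrite mulr0; apply: hat0.
apply: hat_of_local => [|P hP]; first by rewrite mulf_neq0 ?YZ_neq0.
have [n [f [g [fg E]]]] := hw _ hP.
have -> : h = \sum_(i < n) f i * del (g i).
  apply: dX_inj; rewrite -wE E scaler_suml.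
  by apply: eq_bigr => i _; rewrite d_del scalerA.
rewrite mulr_sumr; apply: big_ind => [|f1 f2|i _].
- by exists 1; rewrite ?rmorph1 ?oner_eq0 // mulr0; apply: hat0.
- exact: local_hatD.
- by case: (fg i); apply: local_hat_del.
Qed.

Hypothesis sep : forall c, root (kr * ks) c -> (kr * ks)^`().[c] != 0.

(* At a branch point, y_s (over a root of k_r) or y_r (over a root of k_s) is a
   local parameter. *)
Lemma hat_H0_affine f : hat f -> H0_affine io d ((f / (Y * Z)) *: d X).
Proof.
move=> [u [w ->]] P hP.
suff [a [b [t [Pb E]]]] : exists a b t, P b != 0 /\
    io (u * yr + w * ys) / (Y * Z) = io a / io b * del (io t).
  exists 1%N, (fun=> io a / io b), (fun=> io t); split=> [_|].
    split; first by exists a, b.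
    by exists t, 1; rewrite rmorph1 oner_eq0 rmorph1 divr1.
  by rewrite big_ord1 (d_del (io t)) scalerA E.
have t0 := three_neq0; have Y0 := Y_neq0; have Z0 := Z_neq0.
(* Where y_r y_s does not vanish, the coefficient of dx is already regular. *)
have [PB|PB] := eqVneq (P (yr * ys)) 0; last first.
  exists (u * yr + w * ys), (yr * ys), xx; split=> //.
  by rewrite delX mulr1 (rmorphM io yr ys).
have rt : root (kr * ks) (P xx).
  by rewrite /root -closed_point_ofx // rmorphM -yr_ys PB.
have := sep rt; rewrite derivM hornerD !hornerM.
move: rt; rewrite rootM => /orP [/eqP kr_0|/eqP ks_0].
  rewrite kr_0 mul0r addr0 mulf_eq0 negb_or => /andP [kr'0 ksn0].
  pose q := (kr * ks ^+ 2)^`().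
  have Pq : P (ofx kr ks q) != 0.
    rewrite closed_point_ofx // /q derivM hornerD !hornerM kr_0 mul0r addr0.
    by rewrite !mulf_neq0.
  (* Obtained from 3 y_s^2 dy_s = q dx and y_s^2 = y_r k_s; at the branch point q takes the nonzero
     value k_r' k_s^2. *)
  exists (3%:R * (u * ys + w * ofx kr ks ks)), (ofx kr ks q), ys; split=> //.
  have q0 := point_neq0 Pq.
  rewrite /q -del_Z in q0 *.
  rewrite !(rmorphM io) (rmorph_nat io) !(rmorphD io) !(rmorphM io).
  have -> : pX ks = Z * Z / Y by rewrite Z_Z mulrAC divff // mul1r.
  have dZ0 : del Z != 0 by apply: contraNneq q0 => ->; rewrite mulr0.
  by field; rewrite t0 Y0 Z0 dZ0.
rewrite ks_0 mulr0 add0r mulf_eq0 negb_or => /andP [krn0 ks'0].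
pose q := (kr ^+ 2 * ks)^`().
have Pq : P (ofx kr ks q) != 0.
  rewrite closed_point_ofx // /q derivM hornerD !hornerM ks_0 mulr0 add0r.
  by rewrite !mulf_neq0.
exists (3%:R * (u * ofx kr ks kr + w * yr)), (ofx kr ks q), yr; split=> //.
have q0 := point_neq0 Pq.
rewrite /q -del_Y in q0 *.
rewrite !(rmorphM io) (rmorph_nat io) !(rmorphD io) !(rmorphM io).
have -> : pX kr = Y * Y / Z by rewrite Y_Y mulrAC divff // mul1r.
have dY0 : del Y != 0 by apply: contraNneq q0 => ->; rewrite mulr0.
by field; rewrite t0 Y0 Z0 dY0.
Qed.

(* d/dx raises the order at infinity by at least 3, as dx has order -4. *)
Definition del_val_ge3 (f : K) : Prop := val_ge v (v f + 3) (del f).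

Lemma val3 : v 3%:R = 0.
Proof. by rewrite -(rmorph_nat sc) (val_const hvn) ?pnatr_eq0. Qed.

Lemma del_val_ge3M f g : f != 0 -> g != 0 ->
  del_val_ge3 f -> del_val_ge3 g -> del_val_ge3 (f * g).
Proof.
move=> f0 g0 hf hg; rewrite /del_val_ge3 delM (valM hvn) //.
have vf : val_ge v (v f) f by right.
have vg : val_ge v (v g) g by right.
apply: (val_geD hvn); first by rewrite -addrA; apply: (val_geM hvn).
by rewrite [v f + v g]addrC -addrA; apply: (val_geM hvn).
Qed.

Lemma del_val_ge3_div f g : f != 0 -> g != 0 ->
  del_val_ge3 f -> del_val_ge3 g -> del_val_ge3 (f / g).
Proof.
move=> f0 g0 hf hg; rewrite /del_val_ge3 del_div // (valM hvn) ?invr_eq0 //.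
rewrite (valV hvn) //.
have vg : val_ge v (- v g) g^-1 by right; rewrite (valV hvn).
apply: (val_geB hvn).
  have -> : v f - v g + 3 = - v g + (v f + 3) by ring.
  exact: (val_geM hvn).
have -> : v f - v g + 3 = v f - v g *+ 2 + (v g + 3) by ring.
apply: (val_geM hvn) => //; right.
by rewrite (valM hvn) ?invr_eq0 ?expf_neq0 // (valV hvn) ?expf_neq0 // (valXn hvn).
Qed.

(** Differentiation lowers the degree in x, and each degree counts 3 in the order. *)
Lemma del_val_ge3_pX p : p != 0 -> del_val_ge3 (pX p).
Proof.
move=> p0; rewrite /del_val_ge3 del_pX.
have [->|p'0] := eqVneq p^`() 0; first by rewrite !rmorph0; left.
right; rewrite (val_pX p0).2 (val_pX p'0).2 val_X.
have := lt_size_deriv p0; move: p'0; rewrite -size_poly_gt0.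
by case: (size p^`()) => [//|m _]; case: (size p) => [//|n]; lia.
Qed.

Lemma del_val_ge3_cube f : f != 0 -> del_val_ge3 (f ^+ 3) -> del_val_ge3 f.
Proof.
move=> f0; rewrite /del_val_ge3 del_cube (valXn hvn) //.
have c0 : 3%:R * f ^+ 2 != 0 by rewrite mulf_neq0 ?three_neq0 ?expf_neq0.
have vc : val_ge v (- (v f *+ 2)) (3%:R * f ^+ 2)^-1.
  right; rewrite (valV hvn) // (valM hvn) ?three_neq0 ?expf_neq0 //.
  by rewrite val3 add0r (valXn hvn).
move=> /(val_geM hvn vc); rewrite mulKf //.
by apply: val_gew; lia.
Qed.

Lemma del_val_ge3_mono k : (k.2 < 3)%N -> del_val_ge3 (mono k).
Proof.
have X0 : X != 0 := val_X_lt0.1.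
case: k => i j /= j3; rewrite /mono /=.
have one_ge3 : del_val_ge3 1.
  by left; have := delC 1; rewrite rmorph1.
have g0 : nth 0 [:: 1; Y; Z] j != 0.
  by case: j j3 => [|[|[|//]]] _ /=; rewrite ?oner_eq0 ?Y_neq0 ?Z_neq0.
apply: del_val_ge3M => //; first by rewrite expf_neq0.
  elim: i => [|i IH]; first by rewrite expr0.
  rewrite exprS; apply: del_val_ge3M; rewrite ?expf_neq0 //.
  by right; rewrite delX (val1 hvn) val_X.
case: j {g0} j3 => [|[|[|//]]] _ //=; apply: del_val_ge3_cube.
- exact: Y_neq0.
- by rewrite Y_cube; apply: del_val_ge3_pX; rewrite mulf_neq0 ?expf_neq0.
- exact: Z_neq0.
- by rewrite Z_cube; apply: del_val_ge3_pX; rewrite mulf_neq0 ?expf_neq0.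
Qed.

Lemma del_sum (I : Type) (S : seq I) (F : I -> K) :
  del (\sum_(i <- S) F i) = \sum_(i <- S) del (F i).
Proof.
elim: S => [|i S IH]; first by rewrite !big_nil del0.
by rewrite !big_cons delD IH.
Qed.

(** The bound does not pass to sums in general, since cancellation can raise v(f). In an expansion
    into monomials of distinct orders, every term has order at least that of the sum. *)
Lemma del_val f : f != 0 -> del_val_ge3 f.
Proof.
move=> f0; have [a [b [a0 b0 ->]]] := fraction_neq0 f0.
suff hA c : io c != 0 -> del_val_ge3 (io c) by apply: del_val_ge3_div; auto.
move=> c0; have [n [e [k [_ _ _ _ [cE kmin]]]]] := mono_lead c0.
rewrite /del_val_ge3 {2}cE del_sum big_seq; apply: (val_ge_sum hvn) => j jn.
rewrite delM delC mulr0 addr0.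
have [->|ej] := eqVneq (e j) 0; first by rewrite rmorph0 mul0r; left.
apply: (val_geMl hvn).
apply: val_gew (del_val_ge3_mono (mono_index_lt jn)).
by rewrite lerD2r kmin.
Qed.

Lemma del_val_ge1 f : val_ge v 1 f -> val_ge v 4 (del f).
Proof.
move=> [->|f1]; first by left; apply: del0.
have [->|f0] := eqVneq f 0; first by left; apply: del0.
by apply: val_gew (del_val f0); lia.
Qed.

Lemma del_val_integral f : val_ge v 0 f -> val_ge v 4 (del f).
Proof.
have [->|f0] := eqVneq f 0; first by left; apply: del0.
move=> /(val_geP f0); rewrite le_eqVlt => /predU1P [vf|vf]; last first.
  by apply: del_val_ge1; right; lia.
have [c] := residue f0 (esym vf) => /del_val_ge1.
by rewrite delB delC subr0.
Qed.

(** The unit x t^3 has derivative t^3 + 3 x t^2 t' of order at least 4. Since t^3 has order 3, so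
    must 3 x t^2 t', and this fixes the order of t'. *)
Lemma del_uniformizer t : t != 0 -> v t = 1 -> del t != 0 /\ v (del t) = 4%:Z.
Proof.
move=> t0 vt; have X0 : X != 0 := val_X_lt0.1.
have f0 : X * t ^+ 3 != 0 by rewrite mulf_neq0 ?expf_neq0.
have vf : v (X * t ^+ 3) = 0.
  by rewrite (valM hvn) ?expf_neq0 // (valXn hvn) // val_X vt.
have [c /del_val_ge1] := residue f0 vf.
rewrite delB delC subr0 delM del_cube delX mulr1 => h4.
have nt0 : - t ^+ 3 != 0 by rewrite oppr_eq0 expf_neq0.
have vnt : v (- t ^+ 3) = 3%:Z by rewrite (valN hvn) (valXn hvn) // vt.
have := val_dominant hvn nt0; rewrite vnt => /(_ _ h4) [].
rewrite addrC addrK => n0.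
have dt0 : del t != 0 by apply: contraNneq n0 => ->; rewrite !mulr0.
rewrite !(valM hvn) ?mulf_neq0 ?three_neq0 ?expf_neq0 // val3 vt val_X.
by move=> E; split=> //; move: E; lia.
Qed.

Lemma regular_at_infinity h :
  regular_at d (valuation_ring v) (h *: d X) <-> val_ge v 4 h.
Proof.
split=> [[n [f [g [fg E]]]]|h4].
  have -> : h = \sum_(i < n) f i * del (g i).
    apply: dX_inj; rewrite /= E scaler_suml.
    by apply: eq_bigr => i _; rewrite (d_del (g i)) scalerA.
  apply: (val_ge_sum hvn) => i _; have [fi gi] := fg i.
  by have := val_geM hvn fi (del_val_integral gi); rewrite add0r.
have [_ _ _ /(_ 1) [t t0 vt]] := hvn.
have [dt0 vdt] := del_uniformizer t0 vt.
exists 1%N, (fun=> h / del t), (fun=> t); split=> [_|]; last first.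
  by rewrite big_ord1 (d_del t) scalerA divfK.
split; last by right; rewrite vt.
have vV : val_ge v (- 4%:Z) (del t)^-1 by right; rewrite (valV hvn) // vdt.
by have := val_geM hvn h4 vV; rewrite subrr.
Qed.

Lemma hat_expand f : hat f ->
  exists p q t, f = pX p * Y + pX q * Z + pX t * (Y * Z).
Proof.
move=> [u [w ->]]; have [p [q [t ->]]] := curve_span u.
have [p' [q' [t' ->]]] := curve_span w.
exists (p + t' * ks), (q * kr + p'), (t + q').
rewrite !(rmorphD, rmorphM) /=.
transitivity (pX p * Y + pX q * (Y * Y) + pX t * (Y * Z) +
  (pX p' * Z + pX q' * (Y * Z) + pX t' * (Z * Z))); first by ring.
by rewrite Y_Y Z_Z; ring.
Qed.

(** * The hat monomials ordered by weight, and the two bases *)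

Section Basis.
Variable phi : nat -> A.
Hypothesis phi_mono : forall i, hat_monomial (phi i).
Hypothesis phi_onto : forall f, hat_monomial f -> exists i, f = phi i.
Hypothesis phi_incr : forall i, weight io v (phi i) < weight io v (phi i.+1).

Lemma hat_monomial_weight f : hat_monomial f ->
  io f != 0 /\ exists2 n, hat_weight r s n & v (io f) = - n%:Z.
Proof.
have X0 : X != 0 := val_X_lt0.1; have Xa a : X ^+ a != 0 by rewrite expf_neq0.
have vXa a : v (X ^+ a) = - (3 * a)%N%:Z by rewrite (valXn hvn) // val_X; lia.
move=> [a [|  |] ->]; rewrite !rmorphM rmorphXn.
- split; first by rewrite mulf_neq0 ?Y_neq0.
  exists (3 * a + (2 * r + s))%N; first by exists a; apply: Or31.
  by rewrite (valM hvn) ?Y_neq0 // vXa val_Y; lia.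
- split; first by rewrite mulf_neq0 ?Z_neq0.
  exists (3 * a + (r + 2 * s))%N; first by exists a; apply: Or32.
  by rewrite (valM hvn) ?Z_neq0 // vXa val_Z; lia.
- split; first by rewrite !mulf_neq0 ?Y_neq0 ?Z_neq0.
  exists (3 * a + 3 * (r + s))%N; first by exists a; apply: Or33.
  rewrite !(valM hvn) ?mulf_neq0 ?Y_neq0 ?Z_neq0 // vXa val_Y val_Z; lia.
Qed.

Lemma hat_weight_monomial n : hat_weight r s n ->
  exists2 f, hat_monomial f & v (io f) = - n%:Z.
Proof.
have X0 : X != 0 := val_X_lt0.1; have Xa a : X ^+ a != 0 by rewrite expf_neq0.
have vXa a : v (X ^+ a) = - (3 * a)%N%:Z by rewrite (valXn hvn) // val_X; lia.
move=> [a [] ->].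
- exists (xx ^+ a * yr); first by exists a; apply: Or31.
  by rewrite !rmorphM rmorphXn (valM hvn) ?Y_neq0 // vXa val_Y; lia.
- exists (xx ^+ a * ys); first by exists a; apply: Or32.
  by rewrite !rmorphM rmorphXn (valM hvn) ?Z_neq0 // vXa val_Z; lia.
- exists (xx ^+ a * (yr * ys)); first by exists a; apply: Or33.
  rewrite !rmorphM rmorphXn !(valM hvn) ?mulf_neq0 ?Y_neq0 ?Z_neq0 //.
  by rewrite vXa val_Y val_Z; lia.
Qed.

Lemma phi_neq0 i : io (phi i) != 0.
Proof. by have [] := hat_monomial_weight (phi_mono i). Qed.

Lemma phi_val_lt i j : (i < j)%N -> v (io (phi j)) < v (io (phi i)).
Proof.
elim: j => // j IH; rewrite ltnS leq_eqVlt => /predU1P [->|/IH].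
  by have := phi_incr j; rewrite /weight ltrN2.
by apply: lt_trans; have := phi_incr j; rewrite /weight ltrN2.
Qed.

Lemma phi_val_inj i j : v (io (phi i)) = v (io (phi j)) -> i = j.
Proof.
move=> E; have [/phi_val_lt|/phi_val_lt|//] := ltngtP i j; by rewrite E ltxx.
Qed.

(* The bound says that f / (y_r y_s) has order at least 4, that is, that the
   form is regular at infinity. *)
Lemma phi_val_genus i :
  (i < r + s - 1)%N = (- (3 * (r + s))%N%:Z + 4%:Z <= v (io (phi i))).
Proof.
have [L [uL sL LP]] := hat_weights_below h3.
pose w j := `|v (io (phi j))|%N.
have wE j : hat_weight r s (w j) /\ v (io (phi j)) = - (w j)%:Z.
  have [_ [n hn E]] := hat_monomial_weight (phi_mono j).
  by rewrite /w E abszN absz_nat.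
have w_lt j k : (w j < w k)%N = (j < k)%N.
  have lt j' k' : (j' < k')%N -> (w j' < w k')%N.
    by move=> /phi_val_lt; rewrite (wE j').2 (wE k').2; lia.
  by case: (ltngtP j k) => [/lt|/lt|->]; lia.
have w_inj : injective w.
  by move=> j k E; have [||//] := ltngtP j k; rewrite -w_lt E ltnn.
have -> : (- (3 * (r + s))%N%:Z + 4%:Z <= v (io (phi i)))
    = (w i < 3 * (r + s) - 3)%N.
  by rewrite (wE i).2; lia.
(* Below the bound, the weights of phi_0, ..., phi_i are i + 1 distinct members of [L]. *)
rewrite -sL; have [wi|wi] := ltnP (w i).
  rewrite -(size_iota 0 i.+1) -(size_map w); apply: uniq_leq_size.
    by rewrite map_inj_uniq ?iota_uniq.
  move=> _ /mapP [j ji ->]; apply/LP; split; first by case: (wE j).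
  apply: leq_ltn_trans wi; rewrite leqNgt w_lt -leqNgt.
  by move: ji; rewrite mem_iota.
(* Otherwise all of [L] lies among the weights of phi_0, ..., phi_(i-1). *)
apply/negbTE; rewrite -leqNgt -(size_iota 0 i) -(size_map w (iota 0 i)).
apply: uniq_leq_size => // n /LP [hn nM].
have [f /phi_onto [j ->] vj] := hat_weight_monomial hn.
have <- : w j = n by rewrite /w vj abszN absz_nat.
apply: map_f; rewrite mem_iota /= add0n -(w_lt j i).
by apply: leq_trans wi; rewrite /w vj abszN absz_nat.
Qed.

Lemma hat_phi i : hat (io (phi i)).
Proof.
have [a [] ->] := phi_mono i; rewrite !rmorphM rmorphXn -rmorphXn.
- exact/hatM/hat_Y.
- exact/hatM/hat_Z.
- by apply/hatM/hatM/hat_Z.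
Qed.

(** The polynomial [p] serves only as a finitely supported sequence of coefficients. *)
Definition phi_span (f : K) : Prop :=
  exists p : {poly C}, f = \sum_(i < size p) sc p`_i * io (phi i).

Lemma phi_sum_wide n (p : {poly C}) : (size p <= n)%N ->
  \sum_(i < size p) sc p`_i * io (phi i) = \sum_(i < n) sc p`_i * io (phi i).
Proof.
move=> pn; rewrite (big_ord_widen n (fun i => sc p`_i * io (phi i))) // big_mkcond.
apply: eq_bigr => i _; case: ltnP => // hi.
by rewrite nth_default // rmorph0 mul0r.
Qed.

Lemma phi_spanD f g : phi_span f -> phi_span g -> phi_span (f + g).
Proof.
move=> [p ->] [q ->]; exists (p + q).
rewrite (phi_sum_wide (size_polyD p q)) (phi_sum_wide (leq_maxl _ (size q))).
rewrite (phi_sum_wide (leq_maxr (size p) _)).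
rewrite -big_split; apply: eq_bigr => i _.
by rewrite coefD rmorphD mulrDl.
Qed.

Lemma phi_span_monomial c f : hat_monomial f -> phi_span (sc c * io f).
Proof.
move=> /phi_onto [i ->]; exists (c *: 'X^i).
have [->|c0] := eqVneq c 0.
  by rewrite scale0r size_poly0 big_ord0 rmorph0 mul0r.
rewrite size_scale // size_polyXn (bigD1 ord_max) //= big1 => [|j ji].
  by rewrite coefZ coefXn eqxx mulr1 addr0.
rewrite coefZ coefXn; case: eqP => [ji'|_]; last by rewrite mulr0 rmorph0 mul0r.
by case/eqP: ji; apply/val_inj.
Qed.

Lemma hat_span f : hat f -> phi_span f.
Proof.
have span_pX p m : (forall a, hat_monomial (xx ^+ a * m)) -> phi_span (pX p * io m).
  move=> hm; rewrite (pX_coef (leqnn _)) mulr_suml.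
  apply: big_ind => [|f1 f2|i _].
  - by exists 0; rewrite size_poly0 big_ord0.
  - exact: phi_spanD.
  - by rewrite -mulrA -rmorphXn -rmorphM; apply: phi_span_monomial.
move=> /hat_expand [p [q [t ->]]]; rewrite -(rmorphM io yr ys).
by do 2?[apply: phi_spanD]; apply: span_pX => a; exists a;
  [apply: Or31|apply: Or32|apply: Or33].
Qed.

Lemma basis_H0_affine : is_basis sc (H0_affine io d)
  (fun i : nat => (io (phi i) / (Y * Z)) *: d X).
Proof.
split=> [i|S c uS|w].
- exact/hat_H0_affine/hat_phi.
- under eq_bigr do rewrite scalerA mulrA.
  rewrite -scaler_suml -mulr_suml => /eqP.
  rewrite scaler_eq0 (negPf dX_neq0) orbF mulf_eq0 invr_eq0.
  rewrite (negPf YZ_neq0) orbF => /eqP.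
  apply: (val_independent hvn uS) => [i _|i j _ _]; first exact: phi_neq0.
  exact: phi_val_inj.
- move=> /H0_affine_hat [f [/hat_span [p ->] ->]].
  exists (iota 0 (size p)), (fun i => p`_i).
  rewrite sum_iota mulr_suml scaler_suml; apply: eq_bigr => i _.
  by rewrite scalerA mulrA.
Qed.

Lemma basis_H0 : is_basis sc (H0 io d v)
  (fun i : 'I_(r + s - 1) => (io (phi i) / (3%:R * (Y * Z))) *: d X).
Proof.
have t0 := three_neq0; have yz0 := YZ_neq0.
have vYZ : v (Y * Z) = - (3 * (r + s))%N%:Z.
  by rewrite (valM hvn) ?Y_neq0 ?Z_neq0 // val_Y val_Z; lia.
have e3 i : io (phi i) / (3%:R * (Y * Z)) = (io (phi i) / 3%:R) / (Y * Z).
  by rewrite invfM mulrA.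
split=> [i|S c uS|w [wA winf]].
- rewrite e3; split.
    apply: hat_H0_affine; rewrite mulrC -(rmorph_nat sc) -fmorphV.
    exact/hatM/hat_phi.
  apply/regular_at_infinity; right.
  rewrite !(valM hvn) ?mulf_neq0 ?invr_eq0 ?phi_neq0 // !(valV hvn) //.
  have := ltn_ord i; rewrite phi_val_genus vYZ val3; lia.
- under eq_bigr do rewrite e3 scalerA !mulrA.
  rewrite -scaler_suml -!mulr_suml => /eqP.
  rewrite scaler_eq0 (negPf dX_neq0) orbF !mulf_eq0 !invr_eq0.
  rewrite (negPf yz0) (negPf t0) !orbF => /eqP.
  apply: (val_independent hvn uS) => [i _|i j _ _]; first exact: phi_neq0.
  by move=> /phi_val_inj; apply: val_inj.
- have [f [/hat_span [p fE] wE]] := H0_affine_hat wA.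
  (* Distinct orders cannot cancel, so the bound at infinity on the whole sum applies to each phi_i
     that occurs. *)
  have pi i : p`_i != 0 -> (i < r + s - 1)%N.
    move=> pi0; have ip : (i < size p)%N.
      by rewrite ltnNge; apply: contra_neqN pi0 => ip; rewrite nth_default.
    rewrite phi_val_genus.
    move: winf; rewrite wE => /regular_at_infinity h4.
    have yzge : val_ge v (- (3 * (r + s))%N%:Z) (Y * Z) by right; rewrite vYZ.
    have := val_geM hvn h4 yzge; rewrite divfK // fE addrC.
    rewrite -(sum_iota _ (fun i => sc p`_i * io (phi i))) => hge.
    apply: (val_ge_lead hvn (iota_uniq 0 (size p)) _ _ hge) pi0.
    + by move=> j _; apply: phi_neq0.
    + by move=> j1 j2 _ _; apply: phi_val_inj.
    + by rewrite mem_iota.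
  (* The factor 3 undoes the normalization by 1/3 in the basis forms. *)
  exists (index_enum 'I_(r + s - 1)), (fun i : 'I_(r + s - 1) => 3%:R * p`_i).
  rewrite wE fE; have sp : (size p <= r + s - 1)%N.
    have [->|p0] := eqVneq p 0; first by rewrite size_poly0.
    have := pi (size p).-1; rewrite -lead_coefE lead_coef_eq0 => /(_ p0).
    by rewrite prednK ?size_poly_gt0.
  rewrite (phi_sum_wide sp) mulr_suml scaler_suml; apply: eq_bigr => i _.
  rewrite scalerA; congr (_ *: _); rewrite rmorphM rmorph_nat.
  by field; rewrite t0 Y_neq0 Z_neq0.
Qed.

End Basis.

End Forms.

End Infinity.

End FunctionField.

(** * The branch polynomials *)

Section BranchPolynomials.
Variables (C : numClosedFieldType) (r s : nat) (b : 'I_(r + s) -> C).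

Lemma k_r_k_s : k_r b * k_s b = \prod_(i < r + s) ('X - (b i)%:P).
Proof.
rewrite (bigID (fun i : 'I_(r + s) => (s <= i)%N)) /=; congr (_ * _).
by apply: eq_bigl => i; rewrite ltnNge.
Qed.

Lemma k_rs_neq0 : k_r b != 0 /\ k_s b != 0.
Proof.
have : k_r b * k_s b != 0.
  by rewrite k_r_k_s; apply/prodf_neq0 => i _; rewrite polyXsubC_eq0.
by rewrite mulf_eq0 negb_or => /andP.
Qed.

Lemma size_k_s : (size (k_s b)).-1 = s.
Proof.
rewrite /k_s (big_ord_narrow (leq_addl r s)) size_prod_XsubC.
by rewrite /index_enum -enumT size_enum_ord.
Qed.

(** Taken as the total degree r + s minus s, which avoids reindexing the upper range. *)
Lemma size_k_r : (size (k_r b)).-1 = r.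
Proof.
have [kr0 ks0] := k_rs_neq0.
have := size_mul_pred kr0 ks0; rewrite size_k_s k_r_k_s size_prod_XsubC.
by rewrite /index_enum -enumT size_enum_ord /= => /addIn.
Qed.

Lemma k_r_k_s_separable c : injective b ->
  root (k_r b * k_s b) c -> (k_r b * k_s b)^`().[c] != 0.
Proof.
move=> hb; have : separable_poly (k_r b * k_s b).
  rewrite k_r_k_s -(big_map b xpredT (fun x => 'X - x%:P)).
  by rewrite separable_prod_XsubC map_inj_uniq ?index_enum_uniq.
by rewrite unlock => /coprimep_root; apply.
Qed.

End BranchPolynomials.

Theorem proposition3p7 (R : realType) (r s : nat)
  (hr : (0 < r)%N) (hrs : (r < s)%N) (h3 : r <> s %[mod 3])
  (b : 'I_(r + s) -> R[i]) (hb : injective b)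
  (K : fieldType) (iota : {rmorphism curve_ring (k_r b) (k_s b) -> K})
  (hK : is_fraction_field iota)
  (Omega : lmodType K) (d : K -> Omega)
  (hOmega : is_kaehler (cstK iota) d)
  (v : K -> int) (hv : is_order_at_infinity iota v)
  (phi : nat -> curve_ring (k_r b) (k_s b))
  (phi_mono : forall i, hat_monomial (phi i))
  (phi_onto : forall f, hat_monomial f -> exists i, f = phi i)
  (phi_incr : forall i, weight iota v (phi i) < weight iota v (phi i.+1)) :
  is_basis (cstK iota) (H0_affine iota d)
    (fun i : nat =>
       (iota (phi i) / (iota yr * iota ys)) *: d (iota xx))
  /\
  (* the index i : 'I_g corresponds to nu^I_(i+1) *)
  is_basis (cstK iota) (H0 iota d v)
    (fun i : 'I_(r + s - 1) =>
       (iota (phi i) / (3%:R * (iota yr * iota ys))) *: d (iota xx)).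
Proof.
have [kr0 ks0] := k_rs_neq0 b; have sep := k_r_k_s_separable hb.
have h3' : (size (k_r b)).-1 <> (size (k_s b)).-1 %[mod 3].
  by rewrite size_k_r size_k_s.
have [del [hdel delX]] := exists_del hK kr0 ks0 hv.
split; first exact: (basis_H0_affine hK kr0 ks0 h3' hv hdel delX hOmega sep
  phi_mono phi_onto phi_incr).
have := basis_H0 hK kr0 ks0 h3' hv hdel delX hOmega sep phi_mono phi_onto phi_incr.
by rewrite size_k_r size_k_s.
Qed.
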